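(* Let $A,J_1,\ldots,J_N\in\mathbb{R}^{n\times n}$ and let $0<T_{min}\le T_{max}<\infty$ be given. Then the following statements are equivalent: (a) There exist matrices $P_i\in\mathbb{S}^n_{\succ0}$, $i=1,\ldots,N$, and a nonnegative matrix $\Pi=[\pi_{ij}]\in\mathbb{R}^{N\times N}$ verifying $\mathbf{1}_N^T\Pi=\mathbf{1}_N^T$ such that $$J_i^Te^{A^T\theta}\left(\sum_{j=1}^N\pi_{ji}P_j\right)e^{A\theta}J_i-P_i\prec0$$ holds for all $i=1,\ldots,N$ and all $\theta\in[T_{min},T_{max}]$. (b) There exist scalars $\varepsilon>0$ and $d\in\mathbb{Z}_{\ge0}$ such that the following sum of squares program is feasible using polynomial matrices of degree (at most) $2d$: find symmetric matrix-valued polynomial functions $S_i,\Gamma_i,\Delta_i:\mathbb{R}\to\mathbb{S}^n$, constant matrices $P_i\in\mathbb{S}^n$, $i=1,\ldots,N$, and a nonnegative matrix $\Pi=[\pi_{ij}]\in\mathbb{R}^{N\times N}$ with $\mathbf{1}_N^T\Pi=\mathbf{1}_N^T$ such that, for all $i=1,\ldots,N$: - $\Gamma_i(\cdot)$ and $\Delta_i(\cdot)$ are SOS matrices, - $P_i-\varepsilon I$ is an SOS matrix, - $\dot{S}_i(\tau)-\big(S_i(\tau)A+A^TS_i(\tau)\big)-\Gamma_i(\tau)g(\tau)$ is an SOS matrix (in $\tau$), - $P_i-J_i^TS_i(\theta)J_i-\varepsilon I-\Delta_i(\theta)h(\theta)$ is an SOS matrix (in $\theta$), - $-\sum_{j=1}^N\pi_{ji}P_j+S_i(0)$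 is an SOS matrix.
   Context: $\mathbb{S}^{n}$ is the set of real symmetric $n\times n$ matrices, $\mathbb{S}^{n}_{\succ0}$ the positive definite ones; $X\prec0$ means negative definite. $\mathbf{1}_N$ is the $N$-vector of ones. A nonnegative matrix is a matrix with nonnegative entries. $\dot S_i$ is the derivative of $S_i$ with respect to its argument. The polynomials $g,h$ are $$g(\tau):=\tau(T_{max}-\tau),\qquad h(\theta):=(\theta-T_{min})(T_{max}-\theta).$$ A symmetric (univariate, real) polynomial matrix $\Theta(\cdot)$ is called a sum of squares (SOS) matrix if there exists a (not necessarily square) polynomial matrix $\Xi(\cdot)$ such that $\Theta(\cdot)=\Xi(\cdot)^T\Xi(\cdot)$; a constant matrix is regarded as a polynomial matrix of degree zero. ''Using polynomial matrices of degree (at most) $2d$'' refers to the unknown polynomial matrices $S_i,\Gamma_i,\Delta_i$. *)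

(* Defs.v *)
From HB Require Import structures.
From mathcomp Require Import all_boot all_order all_algebra.
From mathcomp Require Import all_classical all_reals all_analysis.

Set Implicit Arguments.
Unset Strict Implicit.
Unset Printing Implicit Defensive.

Import Order.TTheory GRing.Theory Num.Theory.
Import numFieldNormedType.Exports.

Local Open Scope classical_set_scope.
Local Open Scope ring_scope.

(* The limit is taken in the normed topology of 'M[R]_n. *)
Definition expmx (R : realType) (n : nat) (A : 'M[R]_n) : 'M[R]_n :=
  limn (series (fun k : nat => (k`!%:R)^-1 *: A ^+ k)).

Definition posdefmx (R : realType) (n : nat) (M : 'M[R]_n) : Prop :=
  M^T = M /\ forall x : 'cV[R]_n, x != 0 -> 0 < (x^T *m M *m x) 0 0.

Definition negdefmx (R : realType) (n : nat) (M : 'M[R]_n) : Prop :=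
  M^T = M /\ forall x : 'cV[R]_n, x != 0 -> (x^T *m M *m x) 0 0 < 0.

(* 1^T Pi = 1^T: the columns, not the rows, of Pi sum to one. *)
Definition col_stochastic (R : realType) (N : nat) (Pi : 'M[R]_N) : Prop :=
  (forall i j, 0 <= Pi i j) /\
  (const_mx 1 : 'rV[R]_N) *m Pi = const_mx 1.

(* A univariate polynomial matrix is a matrix over {poly R}; a constant matrix
   is embedded by map_mx polyC. *)
Definition symmetric_polymx (R : realType) (n : nat)
  (Th : 'M[{poly R}]_n) : Prop := Th^T = Th.

Definition sos_mx (R : realType) (n : nat) (Th : 'M[{poly R}]_n) : Prop :=
  symmetric_polymx Th /\
  exists (m : nat) (Xi : 'M[{poly R}]_(m, n)), Th = Xi^T *m Xi.

(* size p is the degree of p plus one, and 0 for p = 0. *)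
Definition degree_le_mx (R : realType) (n : nat) (k : nat)
  (Th : 'M[{poly R}]_n) : Prop := forall i j, (size (Th i j) <= k.+1)%N.

Definition gpoly (R : realType) (Tmax : R) : {poly R} :=
  'X * (Tmax%:P - 'X).

Definition hpoly (R : realType) (Tmin Tmax : R) : {poly R} :=
  ('X - Tmin%:P) * (Tmax%:P - 'X).

Definition sos_program_feasible (R : realType) (n N : nat)
  (A : 'M[R]_n) (J : 'I_N -> 'M[R]_n) (Tmin Tmax eps : R) (d : nat) : Prop :=
  exists (S Gam Del : 'I_N -> 'M[{poly R}]_n)
         (P : 'I_N -> 'M[R]_n) (Pi : 'M[R]_N),
    let Ap := map_mx polyC A in
    let Jp i := map_mx polyC (J i) in
    [/\ forall i, [/\ symmetric_polymx (S i), symmetric_polymx (Gam i),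
                      symmetric_polymx (Del i) & (P i)^T = P i],
        forall i, [/\ degree_le_mx (2 * d) (S i),
                      degree_le_mx (2 * d) (Gam i) &
                      degree_le_mx (2 * d) (Del i)],
        col_stochastic Pi
      & forall i,
        [/\ sos_mx (Gam i) /\ sos_mx (Del i),
            sos_mx (map_mx polyC (P i - eps%:M)),
            sos_mx (map_mx deriv (S i) - (S i *m Ap + Ap^T *m S i)
                    - gpoly Tmax *: Gam i),
            sos_mx (map_mx polyC (P i) - (Jp i)^T *m S i *m Jp i
                    - map_mx polyC eps%:M - hpoly Tmin Tmax *: Del i)
          & sos_mx (map_mx polyC (- (\sum_j Pi j i *: P j)
                                  + map_mx (horner_eval 0) (S i)))]].

(* Main.v *)
(* (b) => (a): along the flow, [e^(-A^T t) S(t) e^(-A t)] is nondecreasing on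
   [0, Tmax], hence [e^(A^T th) S(0) e^(A th) <= S(th)], while [S(0)] dominates
   the mixture of the [P_j] and [J^T S(th) J <= P - eps I].

   (a) => (b): by compactness the strict inequality in (a) holds with a uniform
   margin.  Replace the exponential by a Taylor polynomial [E] and put
   [S = E^T Q E + d (1 + t)^m I], where [Q] is the mixture of the [P_j]; the
   second term makes the differential inequality strict, so that it survives the
   truncation error.  All constraints are then strictly positive polynomial
   matrices on intervals, and such a matrix [M] has a certificate
   [M = Th0 + (t - a) (b - t) Th1]: for an even degree [N], the terms
   [t^k (1 - t)^(N - k)] of the Bernstein expansion of [M] on [0, 1] are squares
   or [t (1 - t)] times squares according to the parity of [k], and for large [N]
   the Bernstein coefficients of [M] are positive definite. *)

Require Import Defs.
From HB Require Import structures.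
From mathcomp Require Import all_boot all_order all_algebra.
From mathcomp Require Import all_classical all_reals all_analysis.
From mathcomp Require Import ring lra zify.
From mathcomp Require polyrcf.

Set Implicit Arguments.
Unset Strict Implicit.
Unset Printing Implicit Defensive.

Import Order.TTheory GRing.Theory Num.Theory.
Import numFieldNormedType.Exports.

Local Open Scope classical_set_scope.
Local Open Scope ring_scope.

(** * Norms and quadratic forms of matrices *)

Lemma mx_normr_ge (R : realType) m n (M : 'M[R]_(m, n)) i j : `|M i j| <= `|M|.
Proof.
by rewrite [leRHS]mx_normrE (le_bigmax _ (fun ij => `|M ij.1 ij.2|) (i, j)).
Qed.

Lemma mx_normr_le (R : realType) m n (M : 'M[R]_(m, n)) c :
  0 <= c -> (forall i j, `|M i j| <= c) -> `|M| <= c.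
Proof. by move=> c0 Mc; rewrite [leLHS]mx_normrE bigmax_le. Qed.

Lemma mx_normr_tr (R : realType) m n (M : 'M[R]_(m, n)) : `|M^T| = `|M|.
Proof.
suff le p q (N : 'M[R]_(p, q)) : `|N^T| <= `|N|.
  by apply/le_anti; rewrite le// -[leLHS]/(`|M|) -{1}(trmxK M) le.
by apply: mx_normr_le => // i j; rewrite mxE mx_normr_ge.
Qed.

(** The norm is the largest absolute entry, so it is submultiplicative only up to the inner
    dimension. *)
Lemma mx_normr_mul (R : realType) m n p (M : 'M[R]_(m, n)) (M' : 'M[R]_(n, p)) :
  `|M *m M'| <= n%:R * `|M| * `|M'|.
Proof.
apply: mx_normr_le => [|i j]; first by rewrite !mulr_ge0.
rewrite mxE (le_trans (ler_norm_sum _ _ _))// -mulrA -[n in n%:R]card_ord.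
rewrite mulr_natl -sumr_const ler_sum// => k _.
by rewrite normrM ler_pM// mx_normr_ge.
Qed.

Definition qf (R : realType) n (M : 'M[R]_n) (v : 'cV[R]_n) : R :=
  (v^T *m M *m v) 0 0.

Definition sqn (R : realType) n (v : 'cV[R]_n) : R := \sum_i v i 0 ^+ 2.

Lemma qfE (R : realType) n (M : 'M[R]_n) v :
  qf M v = \sum_i \sum_j v i 0 * M i j * v j 0.
Proof.
rewrite /qf mxE exchange_big; apply: eq_bigr => j _ /=.
by rewrite mxE mulr_suml; apply: eq_bigr => i _; rewrite !mxE.
Qed.

Lemma qfD (R : realType) n (M M' : 'M[R]_n) v : qf (M + M') v = qf M v + qf M' v.
Proof. by rewrite /qf mulmxDr mulmxDl mxE. Qed.

Lemma qfN (R : realType) n (M : 'M[R]_n) v : qf (- M) v = - qf M v.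
Proof. by rewrite /qf mulmxN mulNmx mxE. Qed.

Lemma qfB (R : realType) n (M M' : 'M[R]_n) v : qf (M - M') v = qf M v - qf M' v.
Proof. by rewrite qfD qfN. Qed.

Lemma qfZ (R : realType) n a (M : 'M[R]_n) v : qf (a *: M) v = a * qf M v.
Proof. by rewrite /qf -scalemxAr -scalemxAl mxE. Qed.

Lemma qf_scale (R : realType) n a (M : 'M[R]_n) v : qf M (a *: v) = a ^+ 2 * qf M v.
Proof.
by rewrite /qf [(a *: v)^T]linearZ /= -!scalemxAl -scalemxAr scalerA mxE expr2.
Qed.

Lemma qf_scalar (R : realType) n a (v : 'cV[R]_n) : qf a%:M v = a * sqn v.
Proof.
rewrite /qf mul_mx_scalar -scalemxAl mxE; congr (_ * _); rewrite mxE.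
by apply: eq_bigr => i _; rewrite !mxE expr2.
Qed.

Lemma qf_congr (R : realType) m n (C : 'M[R]_(m, n)) (M : 'M[R]_m) v :
  qf (C^T *m M *m C) v = qf M (C *m v).
Proof. by rewrite /qf trmx_mul !mulmxA. Qed.

Lemma qf_gram (R : realType) m n (C : 'M[R]_(m, n)) v :
  qf (C^T *m C) v = sqn (C *m v).
Proof. by rewrite -[C^T]mulmx1 qf_congr qf_scalar mul1r. Qed.

Lemma sqn_ge0 (R : realType) n (v : 'cV[R]_n) : 0 <= sqn v.
Proof. by apply: sumr_ge0 => i _; rewrite sqr_ge0. Qed.

Lemma sqn_gt0 (R : realType) n (v : 'cV[R]_n) : v != 0 -> 0 < sqn v.
Proof.
move=> v0; rewrite lt0r sqn_ge0 andbT; apply: contra v0.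
rewrite psumr_eq0 => [/allP v0|i _]; last by rewrite sqr_ge0.
apply/eqP/matrixP => i j; rewrite (ord1 j) mxE.
by have /implyP/(_ isT) := v0 i (mem_index_enum _); rewrite sqrf_eq0 => /eqP.
Qed.

(** Each term is at most [|M|] times the mean of the squares of [v i 0] and [v j 0]; summing over
    both indices produces the factor [n]. *)
Lemma normr_qf_le (R : realType) n (M : 'M[R]_n) v :
  `|qf M v| <= n%:R * `|M| * sqn v.
Proof.
have -> : n%:R * `|M| * sqn v =
    \sum_(i < n) \sum_(j < n) `|M| * ((v i 0 ^+ 2 + v j 0 ^+ 2) / 2).
  transitivity (`|M| * (\sum_(i < n) \sum_(j < n) (v i 0 ^+ 2 + v j 0 ^+ 2) / 2)).
    rewrite -mulrA mulrCA; congr (_ * _).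
    under eq_bigr do rewrite -mulr_suml big_split /= sumr_const card_ord.
    rewrite -mulr_suml big_split /= sumr_const card_ord sumrMnl /sqn -mulr_natl.
    by field.
  by rewrite mulr_sumr; apply: eq_bigr => i _; rewrite mulr_sumr.
rewrite qfE (le_trans (ler_norm_sum _ _ _))// ler_sum// => i _.
rewrite (le_trans (ler_norm_sum _ _ _))// ler_sum// => j _.
rewrite mulrAC mulrC normrM ler_pM// ?mx_normr_ge//.
have := sqr_ge0 (v i 0 - v j 0); have := sqr_ge0 (v i 0 + v j 0).
by rewrite ler_norml => ? ?; apply/andP; split; lra.
Qed.

Lemma posdefmx_ge (R : realType) n mu (M : 'M[R]_n) : 0 < mu -> M^T = M ->
  (forall v, mu * sqn v <= qf M v) -> posdefmx M.
Proof.
move=> mu0 Ms Mmu; split=> // v v0; apply: lt_le_trans (Mmu v).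
by rewrite mulr_gt0// sqn_gt0.
Qed.

(* Cholesky factorization: the Schur complement of the top left entry is again
   positive definite. *)
Lemma posdefmx_gram (R : realType) n (M : 'M[R]_n) : posdefmx M ->
  exists m (C : 'M[R]_(m, n)), M = C^T *m C.
Proof.
elim: n M => [|n IHn] M [Ms Mp].
  by exists 0%N, 0; apply/matrixP => -[].
pose M1 : 'M[R]_(1 + n) := M.
pose a := M1 0 0; pose b : 'rV[R]_n := ursubmx M1; pose D := drsubmx M1.
have ME : M1 = block_mx a%:M b b^T D.
  rewrite -[LHS]submxK; congr block_mx.
    by apply/matrixP=> i j; rewrite !ord1 !mxE /= mulr1n; congr (M1 _ _); apply/val_inj.
  by rewrite /b trmx_ursub /M1 Ms.
have Ds : D^T = D by rewrite /D trmx_drsub /M1 Ms.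
have qb (s : R) (y : 'cV[R]_n) : qf M1 (col_mx s%:M y) =
    a * s ^+ 2 + 2 * (s * (b *m y) 0 0) + qf D y.
  rewrite /qf ME -mulmxA mul_block_col tr_col_mx mul_row_col tr_scalar_mx.
  rewrite !mulmxDr !mulmxA -trmx_mul -mulmxA -scalar_mxM !mul_mx_scalar.
  rewrite !mul_scalar_mx -scalemxAl; move: (b *m y) (y^T *m D *m y) => t q.
  by rewrite !mxE eqxx mulr1n; ring.
have Mp1 (x : 'cV[R]_(1 + n)) : x != 0 -> 0 < qf M1 x := Mp x.
have a_gt0 : 0 < a.
  have : 0 < qf M1 (col_mx 1%:M 0).
    apply/Mp1/eqP => /(congr1 usubmx); rewrite col_mxKu linear0.
    by move=> /matrixP/(_ 0 0)/eqP; rewrite !mxE eqxx oner_eq0.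
  by rewrite qb /qf !mulmx0 !mxE expr1n !mulr0 !addr0 mulr1.
pose D' := D - a^-1 *: (b^T *m b).
have /IHn[m [C CE]] : posdefmx D'.
  split=> [|y y0]; first by rewrite /D' linearB /= linearZ /= trmx_mul trmxK Ds.
  rewrite -/(qf _ _).
  (* The first coordinate [- b y / a] minimizes the form of [M1] for given [y]; the minimum is the
     form of the Schur complement. *)
  have -> : qf D' y = qf M1 (col_mx (- (b *m y) 0 0 / a)%:M y).
    rewrite qb qfB qfZ qf_gram /sqn big_ord1; field; exact: lt0r_neq0.
  apply: Mp1; apply: contra y0 => /eqP e0; apply/eqP.
  by rewrite -[y](col_mxKd (- (b *m y) 0 0 / a)%:M) e0 linear0.
pose C1 := block_mx (Num.sqrt a)%:M ((Num.sqrt a)^-1 *: b) 0 C.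
suff M1E : M1 = C1^T *m C1 by exists (1 + m)%N, C1.
have sa0 : Num.sqrt a != 0 by rewrite sqrtr_eq0 -ltNge.
rewrite ME tr_block_mx mulmx_block !linearZ /= !trmx0 !mulmx0 !mul0mx !addr0.
rewrite tr_scalar_mx -scalar_mxM -expr2 sqr_sqrtr ?ltW//.
rewrite mul_scalar_mx mul_mx_scalar !scalerA mulVf// divff// !scale1r.
by rewrite -scalemxAl scalerA -invfM -expr2 sqr_sqrtr ?ltW// -CE addrC subrK.
Qed.

(** * Sums of squares *)

Lemma sos_gram (R : realType) m n (Xi : 'M[{poly R}]_(m, n)) :
  sos_mx (Xi^T *m Xi).
Proof.
by split; [rewrite /symmetric_polymx trmx_mul trmxK | exists m, Xi].
Qed.

Lemma sos0 (R : realType) n : sos_mx (0 : 'M[{poly R}]_n).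
Proof. by have := sos_gram (0 : 'M[{poly R}]_n); rewrite mulmx0. Qed.

Lemma sosD (R : realType) n (Th Th' : 'M[{poly R}]_n) :
  sos_mx Th -> sos_mx Th' -> sos_mx (Th + Th').
Proof.
move=> [_ [m [Xi ->]]] [_ [m' [Xi' ->]]].
by rewrite -mul_row_col -tr_col_mx; exact: sos_gram.
Qed.

Lemma sos_sum (R : realType) n (I : Type) (r : seq I) (P : pred I)
    (F : I -> 'M[{poly R}]_n) :
  (forall i, P i -> sos_mx (F i)) -> sos_mx (\sum_(i <- r | P i) F i).
Proof. by apply: big_ind; [exact: sos0 | exact: sosD]. Qed.

Lemma sos_sqrZ (R : realType) n (p : {poly R}) (Th : 'M[{poly R}]_n) :
  sos_mx Th -> sos_mx (p ^+ 2 *: Th).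
Proof.
move=> [_ [m [Xi ->]]]; suff -> : p ^+ 2 *: (Xi^T *m Xi) = (p *: Xi)^T *m (p *: Xi).
  exact: sos_gram.
by rewrite [(p *: Xi)^T]linearZ /= -scalemxAl -scalemxAr scalerA.
Qed.

Lemma sos_polyCZ (R : realType) n (c : R) (Th : 'M[{poly R}]_n) :
  0 <= c -> sos_mx Th -> sos_mx (c%:P *: Th).
Proof. by move=> c0; rewrite -(sqr_sqrtr c0) rmorphXn /=; exact: sos_sqrZ. Qed.

Lemma sos_posdef (R : realType) n (M : 'M[R]_n) :
  posdefmx M -> sos_mx (map_mx polyC M).
Proof.
move=> /posdefmx_gram[m [C ->]]; rewrite map_mxM -map_trmx; exact: sos_gram.
Qed.

Lemma sos_comp (R : realType) n (q : {poly R}) (Th : 'M[{poly R}]_n) :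
  sos_mx Th -> sos_mx (map_mx (comp_poly q) Th).
Proof.
by move=> [_ [m [Xi ->]]]; rewrite map_mxM -map_trmx; exact: sos_gram.
Qed.

Lemma sos_sqr (R : realType) n (F : 'M[{poly R}]_n) :
  symmetric_polymx F -> sos_mx (F *m F).
Proof. by move=> Fs; rewrite -{1}Fs; exact: sos_gram. Qed.

Lemma sos_eval_ge0 (R : realType) n (Th : 'M[{poly R}]_n) x v :
  sos_mx Th -> 0 <= qf (map_mx (horner_eval x) Th) v.
Proof.
by move=> [_ [m [Xi ->]]]; rewrite map_mxM -map_trmx qf_gram sqn_ge0.
Qed.

Lemma polyC_eval (R : realType) m n (M : 'M[R]_(m, n)) x :
  map_mx (horner_eval x) (map_mx polyC M) = M.
Proof. by apply/matrixP => i j; rewrite !mxE /horner_eval hornerC. Qed.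

Lemma scalemx_eval (R : realType) m n p (M : 'M[{poly R}]_(m, n)) x :
  map_mx (horner_eval x) (p *: M) = p.[x] *: map_mx (horner_eval x) M.
Proof. exact: map_mxZ. Qed.

(* The ratio ['C(k, l) / 'C(m, l)] is the product of the [(k - i) / (m - i)],
   [i < l], each of which is close to [k / m]. *)
Lemma bin_ratio_approx (R : realType) (d m k l : nat) : (d < m)%N -> (k <= m)%N ->
  (l <= d)%N ->
  `|'C(k, l)%:R / 'C(m, l)%:R - (k%:R / m%:R) ^+ l : R| <= l%:R * (d%:R / (m - d)%:R).
Proof.
move=> dm km; elim: l => [|l IHl] ld; first by rewrite !bin0 divr1 subrr normr0 mul0r.
have lm : (l < m)%N by exact: ltn_trans ld dm.
set r := 'C(k, l)%:R / 'C(m, l)%:R in IHl *; set s := k%:R / m%:R in IHl *.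
pose f : R := (k - l)%:R / (m - l)%:R.
have rE : 'C(k, l.+1)%:R / 'C(m, l.+1)%:R = r * f :> R.
  have := congr1 (fun x => x%:R : R) (mul_bin_left k l).
  have := congr1 (fun x => x%:R : R) (mul_bin_left m l).
  rewrite /= !natrM => hm hk.
  rewrite /r /f mulf_div; apply/eqP; rewrite eqr_div; last 2 first.
  - by rewrite pnatr_eq0 -lt0n bin_gt0.
  - by rewrite mulf_neq0 ?pnatr_eq0 -?lt0n ?bin_gt0 ?subn_gt0// ltnW.
  apply/eqP/(@mulfI _ l.+1%:R); rewrite ?pnatr_eq0//.
  rewrite [LHS]mulrA hk [RHS]mulrCA [_%:R * 'C(m, l.+1)%:R]hm; ring.
have m0 : 0 < m%:R :> R by rewrite ltr0n (leq_ltn_trans _ lm).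
have ml0 : 0 < (m - l)%:R :> R by rewrite ltr0n subn_gt0.
have md0 : 0 < (m - d)%:R :> R by rewrite ltr0n subn_gt0.
have s01 : 0 <= s <= 1.
  by rewrite /s divr_ge0//= ler_pdivrMr// mul1r ler_nat.
have f01 : 0 <= f <= 1.
  by rewrite /f divr_ge0//= ler_pdivrMr// mul1r ler_nat leq_sub2r.
have sf : `|f - s| <= d%:R / (m - d)%:R.
  (* If [k <= l], truncated subtraction makes [f] vanish, and [s] itself is small. *)
  have [kl|lk] := leqP k l.
    rewrite /f (eqP kl) mul0r sub0r normrN ger0_norm; last by case/andP: s01.
    rewrite /s ler_pM ?invr_ge0// ?ler_nat ?(leq_trans kl) ?(ltnW ld)//.
    by rewrite lef_pV2 ?posrE// ler_nat leq_subr.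
  have -> : f - s = - (l%:R / (m - l)%:R * (1 - s)).
    rewrite /f /s !natrB// ?(ltnW lk) ?(ltnW lm)//.
    by field; rewrite -natrB ?(ltnW lm)// !lt0r_neq0.
  rewrite normrN ger0_norm; last first.
    by rewrite mulr_ge0 ?divr_ge0// subr_ge0; case/andP: s01.
  apply: (@le_trans _ _ (l%:R / (m - l)%:R)).
    by rewrite ler_piMr ?divr_ge0// gerBl; case/andP: s01.
  rewrite ler_pM ?invr_ge0// ?ler_nat ?(ltnW ld)//.
  by rewrite lef_pV2 ?posrE// ler_nat leq_sub2l// ltnW.
(* Since [f] and [s ^+ l] lie in [0, 1], the error of the product is at most the sum of the errors
   of its factors. *)
rewrite rE exprS -[X in _ * _ - X]mulrC -[r](subrK (s ^+ l)).
have -> : (r - s ^+ l + s ^+ l) * f - s ^+ l * s = (r - s ^+ l) * f + s ^+ l * (f - s).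
  by ring.
rewrite (le_trans (ler_normD _ _))// -nat1r [leRHS]mulrDl mul1r [leRHS]addrC.
case/andP: s01 f01 => s0 s1 /andP[f0 f1].
apply: lerD; rewrite normrM.
  by rewrite -[leRHS]mulr1 ler_pM ?IHl ?(ltnW ld)// ger0_norm.
by rewrite -[leRHS]mul1r ler_pM// ger0_norm ?exprn_ge0 ?exprn_ile1.
Qed.

(** * Positivity certificates on an interval *)

(** Multiplied by [l! (k - l)! (m - k)!], both sides become [m!]. *)
Lemma bin_mul_bin m k l : (l <= k)%N -> (k <= m)%N ->
  ('C(m, k) * 'C(k, l) = 'C(m, l) * 'C(m - l, k - l))%N.
Proof.
move=> lk km; have lm := leq_trans lk km.
have f0 : (0 < l`! * (k - l)`! * (m - k)`!)%N by rewrite !muln_gt0 !fact_gt0.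
apply/eqP; rewrite -(eqn_pmul2r f0); apply/eqP.
have hmk := bin_fact km; have hkl := bin_fact lk; have hml := bin_fact lm.
have := bin_fact (leq_sub2r l km); rewrite -subnDA subnKC// => hmkl.
transitivity m`!; last first.
  by rewrite -hml -hmkl; ring.
by rewrite -hmk -hkl; ring.
Qed.

Definition bernstein (R : realType) m k : {poly R} :=
  'C(m, k)%:R%:P * ('X^k * (1 - 'X) ^+ (m - k)).

(** Multiply ['X^l] by [((1 - X) + X)^(m - l) = 1] and expand; the terms with [k < l] vanish because
    ['C(k, l)] does. *)
Lemma expr_bernstein (R : realType) m l : (l <= m)%N ->
  'X^l = \sum_(k < m.+1) ('C(k, l)%:R / 'C(m, l)%:R)%:P * bernstein R m k.
Proof.
move=> lm.
rewrite -(big_mkord xpredT (fun k => ('C(k, l)%:R / 'C(m, l)%:R)%:P * bernstein R m k)).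
rewrite (big_cat_nat (leq0n l)) ?leqW//= big_nat big1 ?add0r; last first.
  by move=> k /andP[_ kl]; rewrite bin_small// mul0r polyC0 mul0r.
rewrite -{2}[l]add0n big_addn subSn// big_mkord.
have -> : 'X^l = 'X^l * ((1 - 'X) + 'X) ^+ (m - l) :> {poly R}.
  by rewrite subrK expr1n mulr1.
rewrite exprDn mulr_sumr; apply: eq_bigr => -[i /=]; rewrite ltnS => im _.
have lim : (i + l <= m)%N by rewrite addnC -leq_subRL.
have := congr1 (fun x => x%:R : R) (bin_mul_bin (leq_addl i l) lim).
rewrite addnK !natrM => h.
have hC : 'C(i + l, l)%:R / 'C(m, l)%:R * 'C(m, i + l)%:R = 'C(m - l, i)%:R :> R.
  by rewrite mulrAC [_ * 'C(m, _)%:R]mulrC h mulrC mulKf// pnatr_eq0 -lt0n bin_gt0.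
rewrite /bernstein [RHS]mulrA -polyCM hC polyC_natr [(i + l)%N]addnC subnDA exprD.
by rewrite -mulr_natl; ring.
Qed.

(** As [m] is even, [k] and [m - k] have the same parity: the leftover factors [X] and [1 - X] occur
    together or not at all. *)
Lemma bernstein_parity (R : realType) m k : ~~ odd m -> (k <= m)%N ->
  bernstein R m k = 'C(m, k)%:R%:P *
    (('X * (1 - 'X)) ^+ odd k * ('X^(k./2) * (1 - 'X) ^+ (m - k)./2) ^+ 2).
Proof.
move=> em km; have omk : odd (m - k) = odd k by rewrite oddB// (negbTE em).
rewrite /bernstein; congr (_ * _).
rewrite -{1}[k]odd_double_half -{1}[(m - k)%N]odd_double_half omk.
by rewrite 2!exprMn -!exprM !muln2 !exprD mulrACA.
Qed.

(** The bound [d] on the degree is a parameter, so that all entries of a matrix can share it. *)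
Definition bernstein_coef (R : realType) d m k (p : {poly R}) : R :=
  \sum_(l < d.+1) p`_l * ('C(k, l)%:R / 'C(m, l)%:R).

Lemma bernstein_expansion (R : realType) d m (p : {poly R}) :
  (size p <= d.+1)%N -> (d <= m)%N ->
  p = \sum_(k < m.+1) (bernstein_coef d m k p)%:P * bernstein R m k.
Proof.
move=> pd dm.
have {1}-> : p = \sum_(l < d.+1) (p`_l)%:P * 'X^l.
  have {1}-> : p = \poly_(l < d.+1) p`_l.
    apply/polyP => l; rewrite coef_poly; case: ltnP => // dl.
    by rewrite nth_default// (leq_trans pd).
  by rewrite poly_def; apply: eq_bigr => l _; rewrite mul_polyC.
under eq_bigr => l _.
  rewrite (expr_bernstein R (leq_trans (ltn_ord l : (l <= d)%N) dm)) mulr_sumr; over.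
rewrite exchange_big; apply: eq_bigr => k _ /=.
rewrite /bernstein_coef rmorph_sum mulr_suml; apply: eq_bigr => l _.
by rewrite /= polyCM mulrA.
Qed.

(** A coefficient is the value of [p] at the node [k / m] with each power [(k / m)^l] replaced by a
    nearby ratio of binomials, so the error is of order [1 / m]. *)
Lemma bernstein_coef_approx (R : realType) d m k (p : {poly R}) :
  (size p <= d.+1)%N -> (d < m)%N -> (k <= m)%N ->
  `|bernstein_coef d m k p - p.[k%:R / m%:R]| <=
    (\sum_(l < d.+1) `|p`_l|) * (d%:R * (d%:R / (m - d)%:R)).
Proof.
move=> pd dm km; rewrite (horner_coef_wide _ pd) -sumrB.
rewrite (le_trans (ler_norm_sum _ _ _))// mulr_suml ler_sum// => -[l ld] _ /=.
rewrite -mulrBr normrM ler_wpM2l//.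
rewrite (le_trans (bin_ratio_approx R dm km _))// ler_wpM2r ?divr_ge0//.
by rewrite ler_nat.
Qed.

Lemma sos_certificate01 (R : realType) n (N : 'M[{poly R}]_n) (mu : R) :
  symmetric_polymx N -> 0 < mu ->
  (forall (x : R) v, 0 <= x <= 1 -> mu * sqn v <= qf (map_mx (horner_eval x) N) v) ->
  exists Th0 Th1, [/\ sos_mx Th0, sos_mx Th1 & N = Th0 + ('X * (1 - 'X)) *: Th1].
Proof.
move=> Ns mu0 Nmu.
pose d := \max_ij size (N ij.1 ij.2).
have Nd i j : (size (N i j) <= d.+1)%N.
  by rewrite leqW// (leq_bigmax (F := fun ij => size (N ij.1 ij.2)) (i, j)).
pose c := \sum_i \sum_j \sum_(l < d.+1) `|(N i j)`_l|.
have Nc i j : \sum_(l < d.+1) `|(N i j)`_l| <= c.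
  rewrite /c (bigD1 i)//= (bigD1 j)//= -addrA lerDl addr_ge0// ?sumr_ge0// => *;
    rewrite ?sumr_ge0// => *; rewrite ?sumr_ge0//.
have c0 : 0 <= c by rewrite !sumr_ge0// => ? _; rewrite !sumr_ge0// => ? _; rewrite sumr_ge0.
(* [X <= m - d] is exactly what makes [n] times the coefficient error at most [mu / 2]; [m] is
   chosen even and large enough for this. *)
pose X := n%:R * (c * (d%:R * d%:R)) / (mu / 2).
have X0 : 0 <= X by rewrite !mulr_ge0// invr_ge0 ltW// divr_gt0.
pose m := (d + Num.bound X).+1.*2.
have dm : (d < m)%N by rewrite /m -addnn; lia.
have mX : X <= (m - d)%:R.
  apply: (le_trans (ltW (archi_boundP X0))); rewrite ler_nat /m -addnn; lia.
pose B k : 'M[R]_n := \matrix_(i, j) bernstein_coef d m k (N i j).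
have Bpos k : (k <= m)%N -> posdefmx (B k).
  move=> km; apply: (@posdefmx_ge _ _ (mu / 2)); first by rewrite divr_gt0.
    by apply/matrixP => i j; rewrite !mxE -[in RHS]Ns mxE.
  move=> v; set N' := map_mx (horner_eval (k%:R / m%:R)) N.
  have BN : `|B k - N'| <= c * (d%:R * (d%:R / (m - d)%:R)).
    apply: mx_normr_le => [|i j]; first by rewrite !mulr_ge0.
    rewrite !mxE (le_trans (bernstein_coef_approx (Nd i j) dm km))//.
    by rewrite ler_wpM2r// !mulr_ge0.
  have := Nmu (k%:R / m%:R) v; rewrite divr_ge0//= ler_pdivrMr; last first.
    by rewrite ltr0n (leq_ltn_trans _ dm).
  rewrite mul1r ler_nat => /(_ km); rewrite -/N' => h.
  rewrite -[B k](subrK N') qfD.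
  have : `|qf (B k - N') v| <= mu / 2 * sqn v.
    rewrite (le_trans (normr_qf_le _ _))// ler_wpM2r ?sqn_ge0//.
    rewrite (le_trans (ler_wpM2l _ BN))// mulrA -!mulrA.
    move: mX; rewrite ler_pdivrMr ?divr_gt0// => mX.
    rewrite !mulrA ler_pdivrMr ?ltr0n ?subn_gt0//.
    by rewrite [leRHS]mulrC -!mulrA.
  by rewrite ler_norml => /andP[+ _]; lra.
have NE : N = \sum_(k < m.+1) bernstein R m k *: map_mx polyC (B k).
  apply/matrixP => i j; rewrite summxE (bernstein_expansion (Nd i j) (ltnW dm)).
  by apply: eq_bigr => k _; rewrite !mxE mulrC.
have em : ~~ odd m by rewrite odd_double.
(* Even indices contribute squares to [Th0]; odd ones leave a factor [X (1 - X)] and go to [Th1]. *)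
pose s k : {poly R} := 'X^(k./2) * (1 - 'X) ^+ ((m - k)./2)%N.
exists (\sum_(k < m.+1 | ~~ odd k)
          'C(m, k)%:R%:P *: (s k ^+ 2 *: map_mx polyC (B k))),
       (\sum_(k < m.+1 | odd k)
          'C(m, k)%:R%:P *: (s k ^+ 2 *: map_mx polyC (B k))).
split.
- apply: sos_sum => k _; apply: sos_polyCZ => //; apply: sos_sqrZ.
  by apply/sos_posdef/Bpos; rewrite -ltnS.
- apply: sos_sum => k _; apply: sos_polyCZ => //; apply: sos_sqrZ.
  by apply/sos_posdef/Bpos; rewrite -ltnS.
rewrite NE (bigID (fun k : 'I_m.+1 => odd k)) /= addrC scaler_sumr; congr (_ + _).
  apply: eq_bigr => k /negPf ok; rewrite scalerA bernstein_parity -1?ltnS// ok.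
  by rewrite mul1r.
apply: eq_bigr => k ok; rewrite !scalerA bernstein_parity -1?ltnS// ok.
by rewrite mulrCA mulrA.
Qed.

(** Transport to [0, 1] by the affine map [r] with inverse [q]. Since [X (1 - X)] composed with [q]
    is [hpoly a b / (b - a)^2], the constant is absorbed into [Gam]. *)
Lemma sos_certificate_lt (R : realType) n (M : 'M[{poly R}]_n) (a b mu : R) :
  a < b -> symmetric_polymx M -> 0 < mu ->
  (forall x v, a <= x <= b -> mu * sqn v <= qf (map_mx (horner_eval x) M) v) ->
  exists Gam, sos_mx Gam /\ sos_mx (M - hpoly a b *: Gam).
Proof.
move=> ab Ms mu0 Mmu; have ba0 : 0 < b - a by rewrite subr_gt0.
pose r : {poly R} := a%:P + (b - a)%:P * 'X.
pose q : {poly R} := (b - a)^-1%:P * ('X - a%:P).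
have rq : r \Po q = 'X.
  rewrite /r comp_polyD comp_polyM !comp_polyC comp_polyX /q mulrA -polyCM.
  by rewrite divff ?gt_eqF// mul1r addrC subrK.
have [||Th0 [Th1 [Th0s Th1s NE]]] :=
    @sos_certificate01 R n (map_mx (comp_poly r) M) mu _ mu0.
- by rewrite /symmetric_polymx map_trmx Ms.
- move=> x v /andP[x0 x1].
  have -> : map_mx (horner_eval x) (map_mx (comp_poly r) M) =
            map_mx (horner_eval (a + (b - a) * x)) M.
    by apply/matrixP => i j; rewrite !mxE /horner_eval /= horner_comp /r !hornerE.
  by apply: Mmu; apply/andP; split; nra.
exists (((b - a)^-1 ^+ 2)%:P *: map_mx (comp_poly q) Th1); split.
  by apply: sos_polyCZ; [rewrite sqr_ge0 | exact: sos_comp].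
have -> : M = map_mx (comp_poly q) (map_mx (comp_poly r) M).
  by apply/matrixP => i j; rewrite !mxE /= -comp_polyA rq comp_polyXr.
rewrite NE map_mxD map_mxZ scalerA.
have -> : hpoly a b * ((b - a)^-1 ^+ 2)%:P = comp_poly q ('X * (1 - 'X)).
  rewrite /= comp_polyM comp_polyB comp_polyX comp_polyC /hpoly /q.
  have -> : 1%:P = (b - a)^-1%:P * (b%:P - a%:P) :> {poly R}.
    by rewrite -polyCB -polyCM mulVf// gt_eqF.
  by rewrite rmorphXn /=; ring.
by rewrite addrK; exact: sos_comp.
Qed.

(* Completing the square: [mu + (X - a) F + (X - a)^2 F^2 / (4 mu)] is the
   square of [sqrt mu + (X - a) F / (2 sqrt mu)]. *)
Lemma sos_certificate_eq (R : realType) n (M : 'M[{poly R}]_n) (a mu : R) :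
  symmetric_polymx M -> 0 < mu ->
  (forall v, mu * sqn v <= qf (map_mx (horner_eval a) M) v) ->
  exists Gam, sos_mx Gam /\ sos_mx (M - hpoly a a *: Gam).
Proof.
move=> Ms mu0 Mmu.
(* The division is exact, so [M = M(a) + (X - a) F]. *)
pose F : 'M[{poly R}]_n := \matrix_(i, j) ((M i j - (M i j).[a]%:P) %/ ('X - a%:P)).
have Fs : symmetric_polymx F.
  by apply/matrixP => i j; rewrite !mxE (_ : M j i = M i j)// -[in LHS]Ms mxE.
have ME : M = map_mx polyC (map_mx (horner_eval a) M) + ('X - a%:P) *: F.
  apply/matrixP => i j; rewrite !mxE /horner_eval mulrC divpK; last first.
    by rewrite dvdp_XsubCl /root !hornerE subrr.
  by rewrite addrC subrK.
(* Half of the margin feeds the completed square; the other half keeps [M(a) - nu I] positive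
   definite. *)
have nu0 : 0 < mu / 2 by rewrite divr_gt0.
set nu := mu / 2 in nu0; pose s := Num.sqrt nu.
have ss : s ^+ 2 = nu by rewrite sqr_sqrtr// ltW.
have s0 : s != 0 by rewrite sqrtr_eq0 -ltNge.
exists ((((2 * s)^-1)%:P) ^+ 2 *: (F *m F)); split.
  exact/sos_sqrZ/sos_sqr.
pose Y := (s%:P)%:M + (('X - a%:P) * ((2 * s)^-1)%:P) *: F.
have Ys : symmetric_polymx Y.
  by rewrite /symmetric_polymx linearD /= linearZ /= tr_scalar_mx Fs.
have -> : M - hpoly a a *: (((2 * s)^-1)%:P ^+ 2 *: (F *m F)) =
    map_mx polyC (map_mx (horner_eval a) M - nu%:M) + Y *m Y.
  have -> : Y *m Y = (nu%:P)%:M + ('X - a%:P) *: F +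
      (('X - a%:P) ^+ 2 * ((2 * s)^-1)%:P ^+ 2) *: (F *m F).
    rewrite /Y mulmxDl !mulmxDr mul_scalar_mx mul_mx_scalar mul_scalar_mx.
    rewrite -scalemxAl -scalemxAr !scalerA scale_scalar_mx -polyCM -expr2 ss.
    rewrite !addrA; congr (_ + _ *: _); last by ring.
    rewrite -addrA -scalerDl; congr (_ + _ *: _).
    rewrite mulrCA -mulrDr -polyCM -polyCD -[RHS]mulr1; congr (_ * _%:P).
    by field.
  rewrite {1}ME map_mxB map_scalar_mx /= scalerA /hpoly.
  have -> : ('X - a%:P) * (a%:P - 'X) = - ('X - a%:P) ^+ 2 :> {poly R} by ring.
  by rewrite mulNr scaleNr opprK !addrA subrK.
apply: sosD (sos_sqr Ys); apply/sos_posdef/(posdefmx_ge nu0).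
  by rewrite linearB /= tr_scalar_mx map_trmx Ms.
move=> v; rewrite qfB qf_scalar; have := Mmu v; have := sqn_ge0 v.
by rewrite /nu => _; lra.
Qed.

Lemma sos_certificate (R : realType) n (M : 'M[{poly R}]_n) (a b mu : R) :
  a <= b -> symmetric_polymx M -> 0 < mu ->
  (forall x v, a <= x <= b -> mu * sqn v <= qf (map_mx (horner_eval x) M) v) ->
  exists Gam, sos_mx Gam /\ sos_mx (M - hpoly a b *: Gam).
Proof.
rewrite le_eqVlt => /predU1P[<- Ms mu0 Mmu|]; last exact: sos_certificate_lt.
by apply: sos_certificate_eq mu0 _ => // v; apply: Mmu; rewrite lexx.
Qed.

(** * Taylor polynomials of the matrix exponential *)

(** The remainder of the scalar exponential series, which will majorize every truncation error of
    the matrix exponential. *)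
Definition exp_tail (R : realType) (x : R) K : R := expR x - series (exp_coeff x) K.

Lemma series0 (V : zmodType) (u : V ^nat) : series u 0 = 0.
Proof. by rewrite /series /= big_geq. Qed.

Lemma exp_tail_ge (R : realType) (x : R) K m : 0 <= x -> (K <= m)%N ->
  series (exp_coeff x) m - series (exp_coeff x) K <= exp_tail x K.
Proof.
move=> x0 Km; rewrite lerD2r /expR.
apply: (nondecreasing_cvgn_le _ (is_cvg_series_exp_coeff x)).
by apply/nondecreasing_series => k _ _; exact: exp_coeff_ge0.
Qed.

Lemma exp_tail_small (R : realType) (x c e : R) : 0 <= c -> 0 < e ->
  exists K, c * exp_tail x K <= e.
Proof.
move=> c0 e0.
(* Dividing by [c + 1] covers the case [c = 0]. *)
have c1 : 0 < e / (c + 1) by rewrite divr_gt0// ltr_wpDl.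
have /cvgrPdist_le/(_ _ c1)[K _ /(_ K (leqnn K)) KE] := is_cvg_series_exp_coeff x.
exists K; have : exp_tail x K <= e / (c + 1) by rewrite (le_trans (ler_norm _)).
rewrite ler_pdivlMr ?ltr_wpDl// => h.
(* [x] may be negative, and then so may the tail. *)
have [t0|t0] := ltP (exp_tail x K) 0.
  by rewrite (le_trans _ (ltW e0))// mulr_ge0_le0// ltW.
by rewrite (le_trans _ h)// mulrC ler_wpM2l// lerDl.
Qed.

Section expmx_approximation.
Context (R : realType) (n : nat).
Implicit Types (A : 'M[R]_n) (t T : R) (K : nat).

(** The scalar whose exponential series dominates that of [t *: A] whenever [|t| <= T]. *)
Definition expmx_radius T A : R := T * (n%:R * `|A|).

Definition expmx_poly A K : 'M[{poly R}]_n :=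
  \sum_(k < K) ((k`!%:R)^-1 *: 'X^k) *: map_mx polyC (A ^+ k).

Definition expmx_term A t k : 'M[R]_n := (k`!%:R)^-1 *: (t *: A) ^+ k.

Lemma exprZmx A t k : (t *: A) ^+ k = t ^+ k *: A ^+ k.
Proof.
elim: k => [|k IHk]; first by rewrite !expr0 scale1r.
by rewrite !exprS IHk -!mulmxE -scalemxAl -scalemxAr scalerA.
Qed.

Lemma expmx_poly_eval A K t :
  map_mx (horner_eval t) (expmx_poly A K) = series (expmx_term A t) K.
Proof.
rewrite /series /= big_mkord raddf_sum; apply: eq_bigr => k _ /=.
rewrite scalemx_eval polyC_eval /expmx_term exprZmx scalerA.
by rewrite hornerZ hornerXn.
Qed.

Lemma expmx_poly0 A K : map_mx (horner_eval 0) (expmx_poly A K.+1) = 1%:M.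
Proof.
rewrite expmx_poly_eval /series /= big_nat_recl// big1 ?addr0.
  by rewrite /expmx_term expr0 invr1 scale1r.
by move=> k _; rewrite /expmx_term scale0r exprS mul0r scaler0.
Qed.

Lemma mx_normr_exp A k : `|A ^+ k| <= (n%:R * `|A|) ^+ k.
Proof.
elim: k => [|k IHk].
  by apply: mx_normr_le => // i j; rewrite !expr0 mxE; case: eqP; rewrite ?normr1 ?normr0.
rewrite !exprS -mulmxE (le_trans (mx_normr_mul _ _))// ler_wpM2l//.
Qed.

Lemma normr_expmx_term A t T k : `|t| <= T ->
  `|expmx_term A t k| <= exp_coeff (expmx_radius T A) k.
Proof.
move=> tT; rewrite /expmx_term exprZmx scalerA normrZ normrM normfV normr_nat normrX.
rewrite /exp_coeff /= -mulrA [leRHS]mulrC ler_wpM2l ?invr_ge0//.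
rewrite /expmx_radius exprMn ler_pM ?exprn_ge0// ?mx_normr_exp//.
by rewrite lerXn2r ?nnegrE// (le_trans _ tT).
Qed.

Lemma expmx_radius_ge0 A t T : `|t| <= T -> 0 <= expmx_radius T A.
Proof. by move=> tT; rewrite !mulr_ge0// (le_trans _ tT). Qed.

(** Domination by a scalar exponential series makes the series of norms converge; the Cauchy
    criterion transfers this to the series itself. *)
Lemma is_cvg_expmx A t : cvgn (series (expmx_term A t)).
Proof.
have /cauchy_cvgP/cauchy_seriesP ncvg : cvgn [normed series (expmx_term A t)].
  apply: series_le_cvg (is_cvg_series_exp_coeff (expmx_radius `|t| A)) => k //=.
    by rewrite exp_coeff_ge0// (@expmx_radius_ge0 A t).
  exact: normr_expmx_term.
apply/cauchy_cvgP/cauchy_seriesP => e /ncvg; apply: filterS => -[k m] /=.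
by rewrite ger0_norm ?sumr_ge0//; apply: le_lt_trans; exact: ler_norm_sum.
Qed.

Lemma series_expmx_sub A t T K m : `|t| <= T -> (K <= m)%N ->
  `|series (expmx_term A t) m - series (expmx_term A t) K| <=
    exp_tail (expmx_radius T A) K.
Proof.
move=> tT Km; apply: le_trans (exp_tail_ge (expmx_radius_ge0 _ tT) Km).
rewrite !sub_series_geq// (le_trans (ler_norm_sum _ _ _))// ler_sum// => k _.
exact: normr_expmx_term.
Qed.

(** The bound holds for every partial sum from [K] on and passes to the limit. *)
Lemma expmx_approx A t T K : `|t| <= T ->
  `|expmx (t *: A) - map_mx (horner_eval t) (expmx_poly A K)| <=
    exp_tail (expmx_radius T A) K.
Proof.
move=> tT; rewrite expmx_poly_eval -/(expmx_term A t).
set s := series _ K.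
have h : (fun m => `|series (expmx_term A t) m - s|) @ \oo --> `|expmx (t *: A) - s|.
  by apply: cvg_norm; apply: cvgB; [exact: is_cvg_expmx | exact: cvg_cst].
rewrite -(cvg_lim _ h)//; apply: limr_le; first by apply/cvg_ex; eexists; exact: h.
by near=> m; apply: series_expmx_sub => //; near: m; exact: nbhs_infty_ge.
Unshelve. all: by end_near. Qed.

Lemma normr_expmx_poly A t T K : `|t| <= T ->
  `|map_mx (horner_eval t) (expmx_poly A K)| <= expR (expmx_radius T A).
Proof.
move=> tT; rewrite expmx_poly_eval.
have := series_expmx_sub A tT (leq0n K).
by rewrite /exp_tail !series0 !subr0.
Qed.

Lemma normr_expmx_le A t T : `|t| <= T -> `|expmx (t *: A)| <= expR (expmx_radius T A).
Proof.
move=> tT; have := expmx_approx A 0 tT.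
by rewrite expmx_poly_eval /exp_tail !series0 !subr0.
Qed.

(** The derivative of [expmx_poly A K.+1] is [A] times [expmx_poly A K], so this difference, up to
    the factor [A], is the defect of the Taylor polynomial in the equation [E' = A E]. *)
Lemma expmx_poly_step A t T K : `|t| <= T ->
  `|map_mx (horner_eval t) (expmx_poly A K.+1) -
    map_mx (horner_eval t) (expmx_poly A K)| <= exp_tail (expmx_radius T A) K.
Proof. by move=> tT; rewrite !expmx_poly_eval series_expmx_sub. Qed.

Lemma deriv_scalemx_polyC (p : {poly R}) (B : 'M[R]_n) :
  map_mx deriv (p *: map_mx polyC B) = p^`() *: map_mx polyC B.
Proof. by apply/matrixP => i j; rewrite !mxE derivM derivC mulr0 addr0. Qed.

Lemma deriv_expmx_poly A K :
  map_mx deriv (expmx_poly A K.+1) = map_mx polyC A *m expmx_poly A K.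
Proof.
rewrite /expmx_poly raddf_sum big_ord_recl mulmx_sumr /= deriv_scalemx_polyC.
rewrite expr0 derivZ derivC scaler0 scale0r add0r; apply: eq_bigr => k _.
rewrite deriv_scalemx_polyC -scalemxAr -map_mxM mulmxE -exprS /bump leq0n add1n.
congr (_ *: _); rewrite derivZ derivXn /= -['X^k *+ _]scaler_nat scalerA factS natrM invfM.
by rewrite mulrAC mulVf ?mul1r// pnatr_eq0.
Qed.

Lemma expmx_poly_comm A K :
  expmx_poly A K *m map_mx polyC A = map_mx polyC A *m expmx_poly A K.
Proof.
rewrite mulmx_suml mulmx_sumr; apply: eq_bigr => k _.
by rewrite -scalemxAl -scalemxAr -!map_mxM !mulmxE -exprS -exprSr.
Qed.

(** Both sides lie within the same tail of one transposed Taylor polynomial, because [A] and [A^T]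
    have equal norms; the tail is arbitrarily small. *)
Lemma expmx_tr A t : expmx (t *: A^T) = (expmx (t *: A))^T.
Proof.
apply/eqP; rewrite -subr_eq0 -normr_le0; apply/ler_addgt0Pr => e e0; rewrite add0r.
have [K] := exp_tail_small (expmx_radius `|t| A) (ler0n R 2) e0.
apply: le_trans.
have trX k : A^T ^+ k = (A ^+ k)^T.
  elim: k => [|k IHk]; first by rewrite !expr0 -[RHS]/((1%:M)^T) trmx1.
  by rewrite exprS exprSr -!mulmxE trmx_mul IHk.
have trE : map_mx (horner_eval t) (expmx_poly A^T K) =
           (map_mx (horner_eval t) (expmx_poly A K))^T.
  rewrite !expmx_poly_eval /series /= raddf_sum; apply: eq_bigr => k _ /=.
  by apply/matrixP => i j; rewrite /expmx_term !exprZmx trX !mxE.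
have h := expmx_approx A K (lexx `|t|).
have := expmx_approx A^T K (lexx `|t|).
rewrite trE /expmx_radius mx_normr_tr -/(expmx_radius _ _) => h'.
rewrite (le_trans (ler_distD (map_mx (horner_eval t) (expmx_poly A K))^T _ _))//.
rewrite mulr2n mulrDl mul1r lerD// -linearB mx_normr_tr distrC.
exact: h.
Qed.

(** Taylor polynomials approximate uniformly for [|s| <= |t| + 1], so continuity follows from that
    of polynomials with three errors of [e / 3]. *)
Lemma continuous_expmx A : continuous (fun t => expmx (t *: A)).
Proof.
move=> t; apply/cvgrPdist_le => e e0.
have [K] := exp_tail_small (expmx_radius (`|t| + 1) A) ler01 (divr_gt0 e0 (ltr0n R 3)).
rewrite mul1r => tailK.
have pc : \forall s \near t, forall ij : 'I_n * 'I_n,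
    `|(expmx_poly A K ij.1 ij.2).[t] - (expmx_poly A K ij.1 ij.2).[s]| <= e / 3.
  apply: (@filter_forall _ _ _ (nbhs t)) => ij.
  by move/cvgrPdist_le : (@continuous_horner _ (expmx_poly A K ij.1 ij.2) t); apply; exact: divr_gt0.
have idc : \forall s \near t, `|t - s| <= 1.
  have : (fun s : R => s) @ t --> t by exact: cvg_id.
  by move/cvgrPdist_le; apply; exact: ltr01.
near=> s.
have pcs : forall ij : 'I_n * 'I_n,
    `|(expmx_poly A K ij.1 ij.2).[t] - (expmx_poly A K ij.1 ij.2).[s]| <= e / 3.
  by near: s.
have sT : `|s| <= `|t| + 1.
  rewrite -lerBlDl (le_trans (lerB_dist _ _))// distrC.
have tT : `|t| <= `|t| + 1 by rewrite lerDl.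
have hs := le_trans (expmx_approx A K sT) tailK.
have ht := le_trans (expmx_approx A K tT) tailK.
set ps := map_mx _ _ in hs; set pt := map_mx _ _ in ht.
have hp : `|pt - ps| <= e / 3.
  apply: mx_normr_le => [|i j]; first by rewrite divr_ge0// ltW.
  rewrite /pt /ps !mxE /horner_eval; exact: (pcs (i, j)).
have -> : expmx (t *: A) - expmx (s *: A) =
  (expmx (t *: A) - pt) + (pt - ps) + (ps - expmx (s *: A)).
  by rewrite !addrA !subrK.
rewrite distrC in hs.
rewrite (le_trans (ler_normD _ _))// (le_trans (lerD (ler_normD _ _) (lexx _)))//.
by rewrite (le_trans (lerD (lerD ht hp) hs))//; lra.
Unshelve. all: by end_near. Qed.

End expmx_approximation.

(** * Compactness and perturbation bounds *)

Lemma continuous_sumr (R : realType) (T : topologicalType) (I : Type) (r : seq I)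
    (F : I -> T -> R) :
  (forall i, continuous (F i)) -> continuous (fun x => \sum_(i <- r) F i x).
Proof.
move=> Fc; elim: r => [|i r IHr] x.
  by under eq_fun do rewrite big_nil; exact: cvg_cst.
under eq_fun do rewrite big_cons.
by apply: cvgD; [exact: Fc | exact: IHr].
Qed.

Lemma continuous_mulmx_entry (R : realType) m n p
    (F : R -> 'M[R]_(m, n)) (G : R -> 'M[R]_(n, p)) :
  (forall i j, continuous (fun t => F t i j)) ->
  (forall i j, continuous (fun t => G t i j)) ->
  forall i j, continuous (fun t => (F t *m G t) i j).
Proof.
move=> Fc Gc i j; under eq_fun do rewrite mxE.
by apply: continuous_sumr => k t; apply: cvgM; [exact: Fc | exact: Gc].
Qed.

(* Compactness of the product of [[a, b]] with the unit sphere. *)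
Lemma posdefmx_uniform (R : realType) n (M : R -> 'M[R]_n) (a b : R) : a <= b ->
  (forall i j, continuous (fun t => M t i j)) ->
  (forall t, a <= t <= b -> posdefmx (M t)) ->
  exists2 mu, 0 < mu & forall t v, a <= t <= b -> mu * sqn v <= qf (M t) v.
Proof.
(* In dimension 0 the unit sphere is empty, but both forms vanish. *)
case: n M => [|n] M ab Mc Mp.
  by exists 1 => // t v _; rewrite qfE /sqn !big_ord0 mulr0.
pose K : set (R * 'rV[R]_n.+1) := `[a, b] `*` [set x | `|x| = 1].
pose f (p : R * 'rV[R]_n.+1) : R := qf (M p.1) p.2^T.
have K0 : K !=set0.
  exists (a, const_mx 1); split => /=; first by rewrite in_itv /= lexx.
  apply/le_anti/andP; split; first by apply: mx_normr_le => // i j; rewrite mxE normr1.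
  by have := mx_normr_ge (const_mx 1 : 'rV[R]_n.+1) 0 0; rewrite mxE normr1.
have Kcompact : compact K.
  apply: compact_setX; first exact: segment_compact.
  apply: bounded_closed_compact.
    exists 1; split => [|x x1 v /= ->]; first exact: num_real.
    exact: ltW.
  apply: (@preimage_closed _ _ (fun x : 'rV[R]_n.+1 => `|x|) [set x | x = 1]).
    by move=> x _; exact: norm_continuous.
  exact: closed_eq.
have fc : continuous f.
  have -> : f = fun p => \sum_i \sum_j p.2 0 i * M p.1 i j * p.2 0 j.
    by apply/funext => p; rewrite /f qfE; under eq_bigr do under eq_bigr do rewrite !mxE.
  have c2 i : continuous (fun p : R * 'rV[R]_n.+1 => p.2 0 i).
    move=> p; apply: (@continuous_comp _ _ _ snd (fun x : 'rV[R]_n.+1 => x 0 i)).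
      exact: cvg_snd.
    exact: coord_continuous.
  apply: continuous_sumr => i; apply: continuous_sumr => j p.
  apply: cvgM; last exact: c2.
  apply: cvgM; first exact: c2.
  apply: (@continuous_comp _ _ _ fst (fun t => M t i j)); first exact: cvg_fst.
  exact: Mc.
have [[t0 x0] /set_mem[/= t0ab x01] min] :=
  compact_EVT_min K0 Kcompact (continuous_subspaceT fc).
have c0 : 0 < f (t0, x0).
  have /Mp[_ Mt0] : a <= t0 <= b by move: t0ab; rewrite in_itv.
  apply: Mt0; apply: contra_eq_neq x01 => /= x00.
  by rewrite -[x0]trmxK x00 trmx0 normr0 eq_sym oner_eq0.
(* The sphere is that of the max norm; [sqn v <= n.+1 * |v|^2] explains the divisor. *)
exists (f (t0, x0) / n.+1%:R) => [|t v tab]; first by rewrite divr_gt0.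
have [->|v0] := eqVneq v 0.
  by rewrite /sqn big1 ?mulr0 ?/qf ?mulmx0 ?mxE// => i _; rewrite mxE expr0n.
have nv0 : 0 < `|v| by rewrite normr_gt0.
have wK : K (t, `|v|^-1 *: v^T).
  by split => //=; rewrite normrZ mx_normr_tr ger0_norm ?invr_ge0// mulVf ?gt_eqF.
have := min _ (mem_set wK); rewrite {2}/f /= => h.
have -> : qf (M t) v = `|v| ^+ 2 * qf (M t) (`|v|^-1 *: v^T)^T.
  by rewrite [(_ *: _)^T]linearZ /= trmxK qf_scale mulrA -exprMn divff ?gt_eqF// expr1n mul1r.
have sv : sqn v <= n.+1%:R * `|v| ^+ 2.
  have -> : n.+1%:R * `|v| ^+ 2 = \sum_(i < n.+1) `|v| ^+ 2.
    by rewrite sumr_const card_ord mulr_natl.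
  apply: ler_sum => i _.
  by rewrite -real_normK ?num_real// lerXn2r ?nnegrE// mx_normr_ge.
have cn0 : 0 <= f (t0, x0) / n.+1%:R by rewrite divr_ge0// ltW.
rewrite (le_trans (ler_wpM2l cn0 sv))//.
by rewrite mulrA divfK ?pnatr_eq0// mulrC ler_wpM2l// exprn_ge0.
Qed.

Lemma mx_normr_mul3 (R : realType) n (U Q V : 'M[R]_n) (c d : R) :
  `|U| <= c -> `|V| <= d -> `|U *m Q *m V| <= n%:R ^+ 2 * `|Q| * c * d.
Proof.
move=> Uc Vd; rewrite (le_trans (mx_normr_mul _ _))//.
rewrite -[leRHS](_ : n%:R * (n%:R * c * `|Q|) * d = _); last by ring.
rewrite ler_pM ?mulr_ge0 ?ler_wpM2l// (le_trans (mx_normr_mul _ _))//.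
by rewrite ler_wpM2r// ler_wpM2l.
Qed.

(** Bounds the cost of replacing the exponential by a Taylor polynomial in a congruence, changing
    one factor at a time. *)
Lemma mx_normr_cong_sub (R : realType) n (X Y Q : 'M[R]_n) (B t : R) :
  `|X| <= B -> `|Y| <= B -> `|X - Y| <= t ->
  `|X^T *m Q *m X - Y^T *m Q *m Y| <= n%:R ^+ 2 * `|Q| * t * B *+ 2.
Proof.
move=> XB YB XYt.
have -> : X^T *m Q *m X - Y^T *m Q *m Y =
    (X - Y)^T *m Q *m X + Y^T *m Q *m (X - Y).
  by rewrite linearB /= !mulmxBl mulmxBr addrA subrK.
rewrite (le_trans (ler_normD _ _))// mulr2n lerD//; first by rewrite mx_normr_mul3// mx_normr_tr.
by rewrite mulrAC mx_normr_mul3// mx_normr_tr.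
Qed.

(** The term left over when a truncated exponential [X] is differentiated inside a congruence; [D]
    is the difference of consecutive Taylor polynomials. *)
Lemma mx_normr_remainder (R : realType) n (A D Q X : 'M[R]_n) (B t : R) :
  `|X| <= B -> `|D| <= t ->
  `|(A *m D)^T *m Q *m X + X^T *m Q *m (A *m D)| <= n%:R ^+ 3 * `|A| * `|Q| * t * B *+ 2.
Proof.
move=> XB Dt.
have ADt : `|A *m D| <= n%:R * `|A| * t.
  by rewrite (le_trans (mx_normr_mul _ _))// ler_wpM2l// mulr_ge0.
have -> : n%:R ^+ 3 * `|A| * `|Q| * t * B = n%:R ^+ 2 * `|Q| * (n%:R * `|A| * t) * B.
  by ring.
rewrite (le_trans (ler_normD _ _))// mulr2n lerD//; first by rewrite mx_normr_mul3// mx_normr_tr.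
by rewrite mulrAC mx_normr_mul3// mx_normr_tr.
Qed.

(** * Mean value bound and derivatives of polynomial matrices *)

Lemma horner_lower (R : realType) (p : {poly R}) (c T : R) : 0 <= T ->
  (forall x, 0 <= x <= T -> - c <= p^`().[x]) -> p.[0] - c * T <= p.[T].
Proof.
rewrite le_eqVlt => /predU1P[<- _|T0 pc]; first by rewrite mulr0 subr0.
have [x /itvP xT] := polyrcf.poly_mvt p T0.
have /pc pcx : 0 <= x <= T by rewrite !ltW ?xT.
rewrite subr0 => h.
by have := ler_wpM2r (ltW T0) pcx; lra.
Qed.

Lemma deriv_mulmx (R : realType) m n p (M : 'M[{poly R}]_(m, n))
    (N : 'M[{poly R}]_(n, p)) :
  map_mx deriv (M *m N) = map_mx deriv M *m N + M *m map_mx deriv N.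
Proof.
apply/matrixP => i j; rewrite !mxE raddf_sum -big_split; apply: eq_bigr => k _ /=.
by rewrite derivM !mxE.
Qed.

Lemma deriv_polyC_mx (R : realType) m n (M : 'M[R]_(m, n)) :
  map_mx deriv (map_mx polyC M) = 0.
Proof. by apply/matrixP => i j; rewrite !mxE derivC. Qed.

(** * The Lyapunov comparison *)

Definition qf_poly (R : realType) n (G : 'M[{poly R}]_n) (v : 'cV[R]_n) : {poly R} :=
  \sum_i \sum_j (v i 0 * v j 0) *: G i j.

Lemma horner_qf_poly (R : realType) n (G : 'M[{poly R}]_n) v t :
  (qf_poly G v).[t] = qf (map_mx (horner_eval t) G) v.
Proof.
rewrite qfE horner_sum; apply: eq_bigr => i _; rewrite horner_sum.
by apply: eq_bigr => j _; rewrite hornerZ mxE mulrAC.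
Qed.

Lemma deriv_qf_poly (R : realType) n (G : 'M[{poly R}]_n) v :
  (qf_poly G v)^`() = qf_poly (map_mx deriv G) v.
Proof.
rewrite raddf_sum; apply: eq_bigr => i _; rewrite raddf_sum.
by apply: eq_bigr => j _; rewrite /= derivZ mxE.
Qed.

Lemma polymx_bounded (R : realType) n (M : 'M[{poly R}]_n) (a b : R) :
  exists c, forall x, a <= x <= b -> `|map_mx (horner_eval x) M| <= c.
Proof.
pose ub i j := sval (poly_itv_bound (M i j) a b).
exists (\sum_i \sum_j `|ub i j|) => x xab.
apply: mx_normr_le => [|i j]; first by rewrite sumr_ge0// => i _; rewrite sumr_ge0.
rewrite mxE (bigD1 i)//= (bigD1 j)//= -addrA ler_wpDr//.
  by rewrite addr_ge0// sumr_ge0// => k _; rewrite sumr_ge0.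
by apply: le_trans (ler_norm _); exact: (svalP (poly_itv_bound (M i j) a b)).
Qed.

Lemma exp_tailS (R : realType) (x : R) K : 0 <= x -> exp_tail x K.+1 <= exp_tail x K.
Proof. by move=> x0; rewrite lerD2l lerN2 seriesSr lerDl exp_coeff_ge0. Qed.

(** The Lyapunov operator: the derivative of [e^(-A^T t) S(t) e^(-A t)] is the congruence of
    [S' - lyap A S] by [e^(-A t)]. *)
Definition lyap (R : realType) n (A : 'M[R]_n) (S : 'M[{poly R}]_n) : 'M[{poly R}]_n :=
  S *m map_mx polyC A + (map_mx polyC A)^T *m S.

(** The product rule for [F^T S F] when [F' = - A (F - D)]: the part with [D] is the price of
    truncating the exponential. *)
Lemma lyapunov_congruence (R : comNzRingType) n (A F D S S' : 'M[R]_n) :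
  (- (A *m (F - D)))^T *m S *m F + F^T *m S' *m F + F^T *m S *m (- (A *m (F - D))) =
  F^T *m (S' - (S *m A + A^T *m S)) *m F +
    ((A *m D)^T *m S *m F + F^T *m S *m (A *m D)).
Proof.
have -> : F^T *m (S' - (S *m A + A^T *m S)) *m F =
    F^T *m S' *m F - (F^T *m S *m (A *m F) + (A *m F)^T *m S *m F).
  by rewrite mulmxBr mulmxBl mulmxDr mulmxDl trmx_mul !mulmxA.
rewrite mulmxBr opprB; move: (A *m F) (A *m D) => X Y.
rewrite [(Y - X)^T]linearB /= !mulmxBl mulmxBr.
move: (_ *m S *m F) (_ *m S *m F) (_ *m S' *m F) (_ *m S *m Y) (_ *m S *m X).
by move=> a b c d e; apply/matrixP => i j; rewrite !mxE; ring.
Qed.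

(* [tau |-> v^T E(th - tau)^T S(tau) E(th - tau) v], with [E] a Taylor
   polynomial of the exponential, is nondecreasing up to a term that vanishes
   as the order of [E] grows; it is a polynomial, so that the mean value theorem
   for polynomials applies. *)
Lemma lyapunov_comparison (R : realType) n (A : 'M[R]_n) (S : 'M[{poly R}]_n)
    (T th : R) :
  (forall t v, 0 <= t <= T ->
     0 <= qf (map_mx (horner_eval t) (map_mx deriv S - lyap A S)) v) ->
  0 <= th <= T -> forall v,
  qf ((expmx (th *: A))^T *m map_mx (horner_eval 0) S *m expmx (th *: A)) v <=
    qf (map_mx (horner_eval th) S) v.
Proof.
move=> S_ge /andP[th0 thT] v; have T0 := le_trans th0 thT.
have [s sP] := polymx_bounded S 0 T.
have thT' : `|th| <= T by rewrite ger0_norm.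
set S0 := map_mx (horner_eval 0) S; set r := exp_tail (expmx_radius T A).
set B := expR (expmx_radius T A).
have r0 k : 0 <= r k by apply: le_trans (normr_ge0 _) (expmx_approx A k thT').
have s0 : 0 <= s by apply: le_trans (sP 0 _); rewrite ?lexx.
(* [c1 * r K] bounds the derivative defect accumulated over [0, th], and [c2 * r K] the mismatch
   with the exact exponential at 0. *)
pose c1 := n%:R * (n%:R ^+ 3 * `|A| * s * B *+ 2) * sqn v * th.
pose c2 := n%:R * (n%:R ^+ 2 * `|S0| * B *+ 2) * sqn v.
have c1_ge0 : 0 <= c1 by rewrite !mulr_ge0 ?mulrn_wge0 ?mulr_ge0 ?exprn_ge0 ?expR_ge0 ?sqn_ge0.
have c2_ge0 : 0 <= c2 by rewrite !mulr_ge0 ?mulrn_wge0 ?mulr_ge0 ?exprn_ge0 ?expR_ge0 ?sqn_ge0.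
apply/ler_addgt0Pr => e e0.
have [K Ke] := exp_tail_small (expmx_radius T A) (addr_ge0 c1_ge0 c2_ge0) e0.
rewrite -/(r K) in Ke.
(* [F k] is the Taylor polynomial at [th - t]: for [k > 0] it is the identity at [t = th], and at
   [t = 0] it approximates [e^(A th)]. *)
pose F k := map_mx (comp_poly (th%:P - 'X)) (expmx_poly A k).
have FE k t : map_mx (horner_eval t) (F k) =
    map_mx (horner_eval (th - t)) (expmx_poly A k).
  by apply/matrixP => i j; rewrite !mxE /horner_eval /= horner_comp !hornerE.
pose Ap := map_mx polyC A.
have dF : map_mx deriv (F K.+1) = - (Ap *m F K).
  have -> : Ap *m F K = map_mx (comp_poly (th%:P - 'X)) (Ap *m expmx_poly A K).
    rewrite map_mxM; congr (_ *m _).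
    by apply/matrixP => i j; rewrite !mxE /= comp_polyC.
  rewrite -deriv_expmx_poly; apply/matrixP => i j; rewrite !mxE /=.
  by rewrite deriv_comp derivB derivC derivX sub0r mulrN1.
pose G := (F K.+1)^T *m S *m F K.+1.
pose D := F K.+1 - F K.
have dG : map_mx deriv G =
    (F K.+1)^T *m (map_mx deriv S - lyap A S) *m F K.+1 +
    ((Ap *m D)^T *m S *m F K.+1 + (F K.+1)^T *m S *m (Ap *m D)).
  have FD : F K = F K.+1 - D by rewrite subKr.
  rewrite /lyap -lyapunov_congruence -FD -dF /G !deriv_mulmx mulmxDl.
  by rewrite -map_trmx.
have G_lower : - (n%:R * (n%:R ^+ 3 * `|A| * s * r K * B *+ 2) * sqn v) * th <=
    (qf_poly G v).[th] - (qf_poly G v).[0].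
  suff : (qf_poly G v).[0] -
      (n%:R * (n%:R ^+ 3 * `|A| * s * r K * B *+ 2) * sqn v) * th <= (qf_poly G v).[th].
    by rewrite mulNr; lra.
  apply: horner_lower => // t /andP[t0 tth].
  have tT : 0 <= t <= T by rewrite t0 (le_trans tth).
  have tT' : `|th - t| <= T by rewrite ger0_norm ?subr_ge0// (le_trans _ thT)// gerBl.
  rewrite deriv_qf_poly horner_qf_poly dG map_mxD !map_mxM -map_trmx qfD qf_congr.
  rewrite ler_wpDl ?S_ge// map_mxD !map_mxM -!map_trmx map_mxM.
  set f := map_mx (horner_eval t) (F K.+1); set h := map_mx (horner_eval t) D.
  set St := map_mx (horner_eval t) S; rewrite polyC_eval.
  have fB : `|f| <= B by rewrite /f FE normr_expmx_poly.
  have hr : `|h| <= r K by rewrite /h map_mxB !FE expmx_poly_step.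
  have Ss : `|St| <= s by exact: sP.
  have : `|qf ((A *m h)^T *m St *m f + f^T *m St *m (A *m h)) v| <=
      n%:R * (n%:R ^+ 3 * `|A| * s * r K * B *+ 2) * sqn v.
    rewrite (le_trans (normr_qf_le _ _))// ler_wpM2r ?sqn_ge0// ler_wpM2l//.
    rewrite (le_trans (mx_normr_remainder _ _ fB hr))// lerMn2r.
    by rewrite !ler_wpM2r ?r0 ?expR_ge0// ler_wpM2l// mulr_ge0// exprn_ge0.
  by rewrite ler_norml => /andP[].
have f_th : (qf_poly G v).[th] = qf (map_mx (horner_eval th) S) v.
  rewrite horner_qf_poly /G !map_mxM -map_trmx FE subrr expmx_poly0.
  by rewrite trmx1 mul1mx mulmx1.
have f_0 : qf ((expmx (th *: A))^T *m S0 *m expmx (th *: A)) v <=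
    (qf_poly G v).[0] + c2 * r K.
  rewrite horner_qf_poly /G !map_mxM -map_trmx FE subr0 -/S0.
  set f := map_mx _ _.
  have fe : `|expmx (th *: A) - f| <= r K.
    by rewrite (le_trans (expmx_approx A K.+1 thT'))// exp_tailS// (@expmx_radius_ge0 _ _ _ th).
  have := mx_normr_cong_sub S0 (normr_expmx_le A thT') (normr_expmx_poly A K.+1 thT') fe.
  rewrite -/f => h; rewrite -lerBlDl -qfB.
  rewrite (le_trans (ler_norm _))// (le_trans (normr_qf_le _ _))//.
  rewrite (le_trans (ler_wpM2r (sqn_ge0 v) (ler_wpM2l (ler0n R n) h)))//.
  by rewrite /c2 -/B le_eqVlt; apply/orP; left; apply/eqP; ring.
move: G_lower f_0; rewrite f_th.
have -> : - (n%:R * (n%:R ^+ 3 * `|A| * s * r K * B *+ 2) * sqn v) * th = - (c1 * r K).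
  by rewrite /c1; ring.
by lra.
Qed.

(** * Lyapunov inequalities for the two summands of the certificate *)

Lemma posdefmx_negdef (R : realType) n (X P : 'M[R]_n) :
  negdefmx (X - P) -> posdefmx (P - X).
Proof.
move=> [Xs Xn]; split=> [|v /Xn]; first by rewrite -opprB linearN /= Xs.
by rewrite -/(qf _ _) -/(qf (P - X) v) -[P - X]opprB qfN oppr_gt0.
Qed.

Lemma lyap_sym (R : realType) n (A : 'M[R]_n) (S : 'M[{poly R}]_n) :
  symmetric_polymx S -> symmetric_polymx (map_mx deriv S - lyap A S).
Proof.
move=> Ss; rewrite /symmetric_polymx linearB /= map_trmx Ss; congr (_ - _).
by rewrite /lyap linearD /= !trmx_mul trmxK Ss addrC.
Qed.

Lemma deriv_scalar_mx (R : realType) n (p : {poly R}) :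
  map_mx deriv (p%:M : 'M[{poly R}]_n) = (p^`())%:M.
Proof. by apply/matrixP => i j; rewrite !mxE derivMn. Qed.

(** Differentiating [(1 + t)^m] gains a factor [m / (1 + t)], which for the stated [m] exceeds the
    form of [A + A^T] on [0, T] by enough to leave [d]. *)
Lemma lyap_scalar_ge (R : realType) n (A : 'M[R]_n) (m : nat) (T d t : R) v :
  0 < d -> 1 + n%:R * (`|A| + `|A|) * (1 + T) <= m%:R -> 0 <= t <= T ->
  forall S : 'M[{poly R}]_n, S = (d *: (1 + 'X) ^+ m)%:M ->
  d * sqn v <= qf (map_mx (horner_eval t) (map_mx deriv S - lyap A S)) v.
Proof.
move=> d0 mT /andP[t0 tT] S SE.
set c := n%:R * (`|A| + `|A|) in mT.
have c0 : 0 <= c by rewrite mulr_ge0// addr_ge0.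
have T0 := le_trans t0 tT.
(* The bound on [m] excludes [m = 0]. *)
case: m mT SE => [|m] mT SE.
  have : 0 < 1 + c * (1 + T) by rewrite ltr_wpDr// mulr_ge0// addr_ge0.
  by rewrite ltNge mT.
have -> : map_mx (horner_eval t) (map_mx deriv S - lyap A S) =
    (d * m.+1%:R * (1 + t) ^+ m)%:M - (d * (1 + t) ^+ m.+1) *: (A + A^T).
  rewrite map_mxB /lyap SE mul_scalar_mx mul_mx_scalar -scalerDr scalemx_eval.
  rewrite map_mxD -map_trmx polyC_eval deriv_scalar_mx map_scalar_mx; congr (_%:M - _ *: _).
    rewrite /= /horner_eval derivZ deriv_exp derivD derivC derivX add0r mul1r.
    by rewrite /= hornerZ hornerMn horner_exp !hornerE -mulr_natl mulrA.
  by rewrite hornerZ horner_exp !hornerE.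
rewrite qfB qf_scalar qfZ.
have AAc : qf (A + A^T) v <= c * sqn v.
  rewrite (le_trans (ler_norm _))// (le_trans (normr_qf_le _ _))//.
  by rewrite ler_wpM2r ?sqn_ge0// ler_wpM2l// (le_trans (ler_normD _ _))// mx_normr_tr.
set q := (1 + t) ^+ m.
have q1 : 1 <= q by rewrite exprn_ege1// lerDl.
have q0 : 0 <= q by exact: le_trans q1.
have h : 1 <= m.+1%:R - c * (1 + t).
  rewrite lerBrDr (le_trans _ mT)// lerD2l ler_wpM2l// lerD2l//.
have dq : 0 <= d * q * (1 + t) by rewrite !mulr_ge0 ?addr_ge0// ltW.
have := ler_wpM2l dq AAc.
have : d * 1 * sqn v <= d * (q * (m.+1%:R - c * (1 + t))) * sqn v.
  apply: ler_wpM2r; first exact: sqn_ge0.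
  apply: ler_wpM2l; first exact: ltW.
  by apply: (le_trans q1); rewrite -[leLHS]mulr1 ler_wpM2l.
by rewrite exprS -/q; nra.
Qed.

(** With the exact exponential the left side would be zero. As [A] commutes with [E], only the
    defect [AD] of the truncation survives. *)
Lemma deriv_cong_expmx_poly (R : realType) n (A Q : 'M[R]_n) K :
  let E := expmx_poly A K.+1 in
  let AD := map_mx polyC A *m (E - expmx_poly A K) in
  let S := E^T *m map_mx polyC Q *m E in
  map_mx deriv S - lyap A S =
    - (AD^T *m map_mx polyC Q *m E + E^T *m map_mx polyC Q *m AD).
Proof.
move=> E AD S; rewrite /S !deriv_mulmx deriv_polyC_mx mulmx0 addr0 -map_trmx.
rewrite deriv_expmx_poly /lyap.
have -> : map_mx polyC A *m expmx_poly A K = map_mx polyC A *m E - AD.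
  by rewrite /AD mulmxBr subKr.
have -> : E^T *m map_mx polyC Q *m E *m map_mx polyC A +
    (map_mx polyC A)^T *m (E^T *m map_mx polyC Q *m E) =
    E^T *m map_mx polyC Q *m (map_mx polyC A *m E) +
    (map_mx polyC A *m E)^T *m map_mx polyC Q *m E.
  by rewrite -!expmx_poly_comm trmx_mul !mulmxA.
move: AD (map_mx polyC A *m E) => Y X.
rewrite [(X - Y)^T]linearB /= mulmxBl mulmxBl mulmxBr.
move: (_ *m _ *m E) (_ *m _ *m E) (_ *m _ *m X) (_ *m _ *m Y) => a b c e.
by apply/matrixP => i j; rewrite !mxE; ring.
Qed.

(** * Construction of the certificate *)

Lemma continuous_expmx_entry (R : realType) n (A : 'M[R]_n) i j :
  continuous (fun t : R => expmx (t *: A) i j).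
Proof.
move=> t; apply: (@continuous_comp _ _ _ (fun t : R => expmx (t *: A)) (fun M : 'M[R]_n => M i j)).
  exact: continuous_expmx.
exact: coord_continuous.
Qed.

(** For fixed [P] and [Pi] the constraints decouple over the indices, the mixture entering as a
    fixed symmetric [Q]. Allowing every [eps] up to a threshold makes a common choice possible. *)
Lemma sos_program_component (R : realType) n (A J P Q : 'M[R]_n) (Tmin Tmax : R) :
  0 < Tmin -> Tmin <= Tmax -> posdefmx P -> Q^T = Q ->
  (forall th, Tmin <= th <= Tmax ->
     negdefmx (J^T *m expmx (th *: A^T) *m Q *m expmx (th *: A) *m J - P)) ->
  exists2 e0, 0 < e0 & forall eps, 0 < eps <= e0 ->
  exists S Gam Del : 'M[{poly R}]_n,
    [/\ symmetric_polymx S, sos_mx Gam, sos_mx Del &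
    [/\ sos_mx (map_mx polyC (P - eps%:M)),
        sos_mx (map_mx deriv S - lyap A S - gpoly Tmax *: Gam),
        sos_mx (map_mx polyC P - (map_mx polyC J)^T *m S *m map_mx polyC J
                - map_mx polyC eps%:M - hpoly Tmin Tmax *: Del)
      & sos_mx (map_mx polyC (- Q + map_mx (horner_eval 0) S))]].
Proof.
move=> Tmin0 TT Ppos Qs neg; have T0 := lt_le_trans Tmin0 TT.
(* A constant family over the degenerate interval [0, 0] gives the margin of [P] alone. *)
have [|mu1 mu1_gt0 muP] := @posdefmx_uniform R n (fun=> P) 0 0 (lexx _) _ (fun _ _ => Ppos).
  by move=> i j; exact: cst_continuous.
pose X th := J^T *m expmx (th *: A^T) *m Q *m expmx (th *: A) *m J.
have [||mu mu_gt0 muX] := @posdefmx_uniform R n (fun th => P - X th) _ _ TT.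
- move=> i j; have -> : (fun t => (P - X t) i j) = (fun t => P i j - X t i j).
    by apply/funext => t; do 2 rewrite mxE.
  move=> t; apply: cvgB; first exact: cvg_cst.
  apply: continuous_mulmx_entry t => k l; last exact: cst_continuous.
  apply: continuous_mulmx_entry; last exact: continuous_expmx_entry.
  move=> {}k {}l; apply: continuous_mulmx_entry => k' l'; last exact: cst_continuous.
  apply: continuous_mulmx_entry; last exact: continuous_expmx_entry.
  by move=> *; exact: cst_continuous.
- by move=> th /neg/posdefmx_negdef.
set B := expR (expmx_radius Tmax A); set r := exp_tail (expmx_radius Tmax A).
pose c := 1 + n%:R * (`|A| + `|A|) * (1 + Tmax).
have c0 : 0 <= c by rewrite !(mulr_ge0, addr_ge0)// ltW.
pose m := Num.bound c.
have cm : c <= m%:R by rewrite ltW// archi_boundP.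
pose pT := (1 + Tmax) ^+ m.
have pT0 : 0 <= pT by rewrite exprn_ge0// addr_ge0// ltW.
pose w := n%:R * `|J^T *m J|.
have w0 : 0 <= w by rewrite mulr_ge0.
have Jw v : sqn (J *m v) <= w * sqn v.
  by rewrite -qf_gram (le_trans (ler_norm _))// normr_qf_le.
(* [d] is so small that the scalar summand of [S], seen through [J], costs at most [mu / 4] in the
   jump condition. *)
pose d := mu / 4 / (1 + pT * w).
have dd0 : 0 < 1 + pT * w by rewrite ltr_wpDr// mulr_ge0.
have d0 : 0 < d by rewrite !divr_gt0.
have dw : d * pT * w <= mu / 4.
  rewrite /d -mulrA mulrAC ler_pdivrMr// ler_wpM2l ?divr_ge0 ?ltW//.
  by rewrite ltrDr.
(* The truncation budget: [d / 2] in the flow condition, [mu / 4] in the jump condition. *)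
pose e1 := Num.min (d / 2) (mu / 4).
have e1_gt0 : 0 < e1 by rewrite lt_min !divr_gt0.
pose C1 := n%:R * (n%:R ^+ 3 * `|A| * `|Q| * B *+ 2).
pose C2 := n%:R * (n%:R ^+ 2 * `|Q| * B *+ 2) * w.
have C1_ge0 : 0 <= C1 by rewrite !mulr_ge0 ?mulrn_wge0 ?mulr_ge0 ?exprn_ge0 ?expR_ge0.
have C2_ge0 : 0 <= C2 by rewrite !mulr_ge0 ?mulrn_wge0 ?mulr_ge0 ?exprn_ge0 ?expR_ge0.
have [K] := exp_tail_small (expmx_radius Tmax A) (addr_ge0 C1_ge0 C2_ge0) e1_gt0.
rewrite -/(r K) mulrDl => CK.
have r0 k : 0 <= r k.
  have T1 : `|Tmax| <= Tmax by rewrite gtr0_norm.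
  exact: le_trans (normr_ge0 _) (expmx_approx A k T1).
have C1K : C1 * r K <= d / 2.
  by apply: le_trans (_ : e1 <= _); [have := mulr_ge0 C2_ge0 (r0 K); lra | rewrite ge_min lexx].
have C2K : C2 * r K <= mu / 4.
  by apply: le_trans (_ : e1 <= _); [have := mulr_ge0 C1_ge0 (r0 K); lra | rewrite ge_min lexx orbT].
exists (Num.min (mu1 / 2) (mu / 4)) => [|eps]; first by rewrite lt_min !divr_gt0.
rewrite le_min => /and3P[eps0 eps1 eps2].
pose E := expmx_poly A K.+1.
pose S1 := E^T *m map_mx polyC Q *m E.
pose S2 : 'M[{poly R}]_n := (d *: (1 + 'X) ^+ m)%:M.
pose S := S1 + S2.
have Ss : symmetric_polymx S.
  rewrite /symmetric_polymx linearD /= /S2 tr_scalar_mx /S1 !trmx_mul trmxK.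
  by rewrite map_trmx Qs mulmxA.
have S_eval t : map_mx (horner_eval t) S =
    (map_mx (horner_eval t) E)^T *m Q *m map_mx (horner_eval t) E + (d * (1 + t) ^+ m)%:M.
  rewrite map_mxD !map_mxM -map_trmx polyC_eval map_scalar_mx /=.
  by rewrite /horner_eval hornerZ horner_exp !hornerE.
have tail t : 0 <= t <= Tmax -> `|t| <= Tmax by case/andP => t0 tT; rewrite ger0_norm.
(* The scalar summand supplies [d] and truncation consumes at most half of it. *)
have [|t v tT|Gam [Gams cert1]] :=
  @sos_certificate R n (map_mx deriv S - lyap A S) 0 Tmax (d / 2) (ltW T0) _ (divr_gt0 d0 (ltr0n R 2)).
- exact: lyap_sym.
- have -> : map_mx deriv S - lyap A S =
      (map_mx deriv S1 - lyap A S1) + (map_mx deriv S2 - lyap A S2).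
    rewrite /lyap /S map_mxD mulmxDl mulmxDr; move: (map_mx deriv S1) => a.
    move: (map_mx deriv S2) (S1 *m _) (S2 *m _) (_ *m S1) (_ *m S2) => b e f g h.
    by apply/matrixP => i j; do 20?[rewrite [in LHS]mxE]; do 20?[rewrite [in RHS]mxE]; ring.
  rewrite map_mxD qfD.
  have h2 := lyap_scalar_ge v d0 cm tT (erefl S2).
  suff : `|qf (map_mx (horner_eval t) (map_mx deriv S1 - lyap A S1)) v| <= d / 2 * sqn v.
    rewrite ler_norml => /andP[+ _]; move: (qf _ v) (qf _ v) (sqn v) h2 => a b q h2.
    by clear -h2; lra.
  rewrite deriv_cong_expmx_poly map_mxN qfN normrN map_mxD !map_mxM -!map_trmx.
  rewrite map_mxM !polyC_eval map_mxB.
  set f := map_mx (horner_eval t) E; set f0 := map_mx (horner_eval t) (expmx_poly A K).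
  have fB : `|f| <= B by exact/normr_expmx_poly/tail.
  have hr : `|f - f0| <= r K by exact/expmx_poly_step/tail.
  rewrite (le_trans (normr_qf_le _ _))// ler_wpM2r ?sqn_ge0// (le_trans _ C1K)//.
  rewrite /C1 -mulrA ler_wpM2l// (le_trans (mx_normr_remainder _ _ fB hr))//.
  by rewrite mulrnAl lerMn2r /= mulrAC.
(* Of the margin [mu], one quarter each goes to truncation, to the scalar summand and to [eps]; the
   last quarter remains. *)
have [|th v tT|Del [Dels cert2]] :=
  @sos_certificate R n (map_mx polyC P - (map_mx polyC J)^T *m S *m map_mx polyC J
                - map_mx polyC eps%:M) Tmin Tmax (mu / 4) TT _ (divr_gt0 mu_gt0 (ltr0n R 4)).
- rewrite /symmetric_polymx !linearB /= map_scalar_mx /= tr_scalar_mx.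
  rewrite [(map_mx polyC P)^T]map_trmx.
  by case: Ppos => -> _; rewrite !trmx_mul trmxK Ss mulmxA.
- have th0 : 0 <= th <= Tmax by case/andP: tT => t0 ->; rewrite (le_trans _ t0)// ltW.
  rewrite !map_mxB !map_mxM -map_trmx !polyC_eval S_eval.
  set f := map_mx (horner_eval th) E; set e := expmx (th *: A).
  rewrite 2!qfB qf_scalar qf_congr qfD qf_scalar.
  have := muX th v tT; rewrite qfB.
  have -> : qf (X th) v = qf (e^T *m Q *m e) (J *m v).
    by rewrite -qf_congr /X expmx_tr !mulmxA.
  have fe : `|f - e| <= r K.
    rewrite distrC (le_trans (expmx_approx A K.+1 (tail th th0)))// exp_tailS//.
    exact: expmx_radius_ge0 (tail th th0).
  have := mx_normr_cong_sub Q (normr_expmx_poly A K.+1 (tail th th0))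
    (normr_expmx_le A (tail th th0)) fe.
  rewrite -/e -/f -/B => he.
  have : qf (f^T *m Q *m f) (J *m v) - qf (e^T *m Q *m e) (J *m v) <= mu / 4 * sqn v.
    rewrite -qfB (le_trans (ler_norm _))// (le_trans (normr_qf_le _ _))//.
    rewrite (le_trans (ler_pM _ (sqn_ge0 _) (ler_wpM2l (ler0n R n) he) (Jw v)))//.
    rewrite mulrA (le_trans _ (ler_wpM2r (sqn_ge0 v) C2K))//.
    by rewrite ler_wpM2r ?sqn_ge0// le_eqVlt; apply/orP; left; apply/eqP; rewrite /C2; ring.
  have : d * (1 + th) ^+ m * sqn (J *m v) <= mu / 4 * sqn v.
    rewrite (le_trans _ (ler_wpM2r (sqn_ge0 v) dw))// -[leRHS]mulrA.
    case/andP: th0 => th0 thT.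
    have th1 : 0 <= 1 + th by rewrite addr_ge0.
    apply: ler_pM (Jw v); [|exact: sqn_ge0|].
      by apply: mulr_ge0; [exact: ltW | exact: exprn_ge0].
    apply: ler_wpM2l; first exact: ltW.
    by rewrite lerXn2r ?nnegrE ?addr_ge0 ?lerD2l// ltW.
  have := ler_wpM2r (sqn_ge0 v) eps2.
  move: (qf P v) (qf (f^T *m Q *m f) _) (qf (e^T *m Q *m e) _) (sqn v) => a b q x.
  by move: (d * _ * _) => y; clear; lra.
exists S, Gam, Del; split=> //; split => //.
- apply/sos_posdef/(posdefmx_ge (mu := mu1 / 2)); first by rewrite divr_gt0.
    by rewrite linearB /= tr_scalar_mx; case: Ppos => ->.
  move=> v; rewrite qfB qf_scalar; have := muP 0 v; rewrite lexx => /(_ isT).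
  have := ler_wpM2r (sqn_ge0 v) eps1; lra.
- by have -> : gpoly Tmax = hpoly 0 Tmax by rewrite /gpoly /hpoly polyC0 subr0.
(* Since [E(0) = I], the matrix [S(0) - Q] is exactly [d I]. *)
- rewrite S_eval expmx_poly0 trmx1 mul1mx mulmx1 addrA addNr add0r addr0 expr1n mulr1.
  by apply/sos_posdef/(posdefmx_ge d0); [rewrite tr_scalar_mx | move=> v; rewrite qf_scalar].
Qed.

Lemma sos_program_of_lyapunov (R : realType) (n N : nat) (A : 'M[R]_n)
  (J : 'I_N -> 'M[R]_n) (Tmin Tmax : R) (P : 'I_N -> 'M[R]_n) (Pi : 'M[R]_N) :
  0 < Tmin -> Tmin <= Tmax -> (forall i, posdefmx (P i)) -> col_stochastic Pi ->
  (forall (i : 'I_N) (th : R), Tmin <= th <= Tmax ->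
     negdefmx ((J i)^T *m expmx (th *: A^T) *m (\sum_j Pi j i *: P j) *m
               expmx (th *: A) *m J i - P i)) ->
  exists (eps : R) (d : nat),
    0 < eps /\ sos_program_feasible A J Tmin Tmax eps d.
Proof.
move=> Tmin0 TT Ppos Pis neg.
have Qs i : (\sum_j Pi j i *: P j)^T = \sum_j Pi j i *: P j.
  rewrite raddf_sum; apply: eq_bigr => j _ /=.
  by rewrite linearZ /=; case: (Ppos j) => ->.
have [e0 e0P] := boolp.choice (fun i =>
  let: ex_intro2 e h1 h2 := sos_program_component Tmin0 TT (Ppos i) (Qs i) (neg i) in
  ex_intro (fun e => _ /\ _) e (conj h1 h2)).
(* The default 1 keeps [eps] positive even when there are no indices. *)
pose eps := \big[Num.min/1]_i e0 i.
have eps0 : 0 < eps.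
  apply: (big_ind (fun x => 0 < x)) => // [x y x0 y0|i _].
    by rewrite lt_min x0.
  by case: (e0P i).
have epsP i : 0 < eps <= e0 i by rewrite eps0 bigmin_le_cond.
have [S SP] := boolp.choice (fun i => (e0P i).2 eps (epsP i)).
have [Gam GamP] := boolp.choice SP.
have [Del DelP] := boolp.choice GamP.
pose d := \max_i \max_ij
  maxn (size (S i ij.1 ij.2)) (maxn (size (Gam i ij.1 ij.2)) (size (Del i ij.1 ij.2))).
have dP i j k : (maxn (size (S i j k)) (maxn (size (Gam i j k)) (size (Del i j k))) <=
    (2 * d).+1)%N.
  apply: (@leq_trans d); last by lia.
  apply: leq_trans (leq_bigmax i).
  exact: (leq_bigmax (F := fun ij => maxn (size (S i ij.1 ij.2)) _) (j, k)).
exists eps, d; split=> //; exists S, Gam, Del, P, Pi; split=> // i.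
- by have [Ss [Gs _] [Ds _] _] := DelP i; split=> //; case: (Ppos i).
- by split=> j k; have := dP i j k; rewrite !geq_max => /and3P[].
- by have [_ Gs Ds [h1 h2 h3 h4]] := DelP i; split.
Qed.

Theorem theorem9 (R : realType) (n N : nat) (A : 'M[R]_n)
  (J : 'I_N -> 'M[R]_n) (Tmin Tmax : R)
  (hTmin : 0 < Tmin) (hT : Tmin <= Tmax) :
  (exists (P : 'I_N -> 'M[R]_n) (Pi : 'M[R]_N),
     [/\ forall i, posdefmx (P i),
         col_stochastic Pi
       & forall (i : 'I_N) (theta : R), Tmin <= theta <= Tmax ->
         negdefmx ((J i)^T *m expmx (theta *: A^T) *m
                   (\sum_j Pi j i *: P j) *m expmx (theta *: A) *m J i - P i)])
  <->
  (exists (eps : R) (d : nat),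
     0 < eps /\ sos_program_feasible A J Tmin Tmax eps d).
Proof.
split=> [[P [Pi [Ppos Pis neg]]]|]; first exact: sos_program_of_lyapunov neg.
move=> [eps [d [eps0 [S [Gam [Del [P [Pi [syms _ Pis cert]]]]]]]]].
have PE i v : eps * sqn v <= qf (P i) v.
  have [_ /sos_eval_ge0 h _ _ _] := cert i; have := h 0 v.
  by rewrite polyC_eval qfB qf_scalar subr_ge0.
have Qs i : (\sum_j Pi j i *: P j)^T = \sum_j Pi j i *: P j.
  rewrite raddf_sum; apply: eq_bigr => j _ /=.
  by rewrite linearZ /=; case: (syms j) => _ _ _ ->.
exists P, Pi; split=> // [i|i th /andP[th1 th2]].
  by apply: (posdefmx_ge eps0) => //; case: (syms i).
have [[Gams Dels] _ flow jump init] := cert i.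
split.
  rewrite linearB /= !trmx_mul trmxK Qs -!expmx_tr trmxK !mulmxA.
  by case: (syms i) => _ _ _ ->.
move=> v v0.
have -> : (J i)^T *m expmx (th *: A^T) *m (\sum_j Pi j i *: P j) *m
    expmx (th *: A) *m J i =
    (J i)^T *m ((expmx (th *: A))^T *m (\sum_j Pi j i *: P j) *m expmx (th *: A)) *m J i.
  by rewrite expmx_tr !mulmxA.
rewrite -/(qf (_ - _) v) qfB !qf_congr.
have th0 : 0 <= th <= Tmax by rewrite th2 (le_trans _ th1)// ltW.
have flow_ge t u : 0 <= t <= Tmax ->
    0 <= qf (map_mx (horner_eval t) (map_mx deriv (S i) - lyap A (S i))) u.
  move=> /andP[t0 tT]; have := sos_eval_ge0 t u flow.
  rewrite map_mxB scalemx_eval qfB qfZ subr_ge0; apply: le_trans.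
  by rewrite mulr_ge0 ?sos_eval_ge0// /gpoly !hornerE mulr_ge0// subr_ge0.
have h1 := lyapunov_comparison flow_ge th0 (J i *m v); rewrite qf_congr in h1.
have := sos_eval_ge0 th v jump.
rewrite !map_mxB !map_mxM -map_trmx !polyC_eval scalemx_eval !qfB qf_scalar qfZ qf_congr.
have h2 : 0 <= (hpoly Tmin Tmax).[th] * qf (map_mx (horner_eval th) (Del i)) v.
  by rewrite mulr_ge0 ?sos_eval_ge0// /hpoly !hornerE mulr_ge0// subr_ge0.
(* The condition at 0 is tested on [e^(A th) J v], the vector at which the comparison lemma
   evaluates [S(0)]. *)
have := sos_eval_ge0 0 (expmx (th *: A) *m (J i *m v)) init.
rewrite polyC_eval qfD qfN => h3 h4.
have h5 := mulr_gt0 eps0 (sqn_gt0 v0).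
(* The chain: the mixture is below [S(0)], carried by the flow below [S(th)], which after the jump
   is below [P i - eps I]; [eps] gives strictness. *)
move: (qf (map_mx _ (S i)) (J i *m v)) (eps * _) (_.[th] * _) h1 h2 h3 h4 h5 => a x y.
move: (qf _ _) (qf _ _) (qf _ _) => b c e; clear; lra.
Qed.
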